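(* Let $\mathcal U$ be a unitary 4-design on $\mathcal H$ and $O$ a traceless Hermitian operator on $\mathcal H$. Then $V_*(O)\le \frac{4}{d}\|O\|_2^2$. If moreover $O=|\phi\rangle\langle\phi|-\mathbb 1/d$ for a pure state $|\phi\rangle\in\mathcal H$, then $$V_*(O)=V_*(O,\phi)=\frac{4(d-1)}{(d+2)(d+3)}<\frac4d.$$
   Context: Let $n\ge1$, $d=2^n$, $\mathcal H=(\mathbb C^2)^{\otimes n}$ with computational basis $\{|\mathbf b\rangle\}_{\mathbf b\in\{0,1\}^n}$. A unitary ensemble $\mathcal U$ is a probability distribution on $U(d)$; its measurement channel is $\mathcal M(X)=\mathbb E_{U\sim\mathcal U}\sum_{\mathbf b}\langle\mathbf b|UXU^\dagger|\mathbf b\rangle\,U^\dagger|\mathbf b\rangle\langle\mathbf b|U$ (for a 2-design, $\mathcal M^{-1}(O)=(d+1)O-\operatorname{tr}(O)\mathbb 1$). For a density operator $\rho$ and traceless Hermitian $O$, $V_*(O,\rho)=\mathbb E_{U\sim\mathcal U}\bigl(\sum_{\mathbf b}\langle\mathbf b|U\rho U^\dagger|\mathbf b\rangle\langle\mathbf b|U\mathcal M^{-1}(O)U^\dagger|\mathbf b\rangle\bigr)^2-[\operatorname{tr}(O\rho)]^2$; $V_*(O)=\max_\rho V_*(O,\rho)$ over all density operators; for a pure state $\rho=|\phi\rangle\langle\phi|$ one writes $V_*(O,\phi)$. $\|O\|_2$ is the Hilbert–Schmidt norm. *)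

(* Defs.v *)
(* Complex numbers are R[i] := complex R
   (mathcomp-real-closed) over an abstract R : realType; the order on R[i] is
   the canonical numClosedField order (x <= y iff y - x is real and >= 0). *)
From HB Require Import structures.
From mathcomp Require Import all_boot all_order all_algebra.
From mathcomp Require Import all_classical all_reals all_analysis.
From mathcomp Require Import complex spectral.

Set Implicit Arguments.
Unset Strict Implicit.
Unset Printing Implicit Defensive.

Import Order.TTheory GRing.Theory Num.Theory.
Local Open Scope ring_scope.
Local Open Scope sesquilinear_scope.

(* Expectations of complex(-matrix)-valued random variables.           *)
(* The expectation of f : T -> R[i] is the Lebesgue integral of its    *)
(* real part plus i times the integral of its imaginary part.          *)
Definition Ec (R : realType) (dT : measure_display) (T : measurableType dT)
  (P : probability T R) (f : T -> R[i]) : R[i] :=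
  Complex (Rintegral P setT (fun t => complex.Re (f t)))
          (Rintegral P setT (fun t => complex.Im (f t))).

Definition Emx (R : realType) (dT : measure_display) (T : measurableType dT)
  (P : probability T R) (m k : nat) (F : T -> 'M[R[i]]_(m, k)) : 'M[R[i]]_(m, k) :=
  \matrix_(i, j) Ec P (fun t => F t i j).

(* A unitary ensemble on C^D: a random matrix U on a probability space    *)
(* (T, P) that is unitary everywhere and whose entries are measurable.   *)
(* (Its law is the probability distribution on U(D) of the paper.)        *)
Definition unitary_ensemble (R : realType) (dT : measure_display)
  (T : measurableType dT) (P : probability T R) (D : nat)
  (U : T -> 'M[R[i]]_D) : Prop :=
  (forall t, U t \is unitarymx) /\
  (forall i j, measurable_fun setT (fun t => complex.Re (U t i j)) /\
               measurable_fun setT (fun t => complex.Im (U t i j))).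

(* The monomial  prod_{a<p} V_{i_a j_a} * prod_{b<q} conj(V_{k_b l_b}). *)
Definition monomial (C : numClosedFieldType) (D p q : nat)
  (i j : 'I_p -> 'I_D) (k l : 'I_q -> 'I_D) (V : 'M[C]_D) : C :=
  (\prod_(a < p) V (i a) (j a)) * \prod_(b < q) (V (k b) (l b))^*.

(* Haar-distributed random unitary: its law is invariant under left and   *)
(* right multiplication by every fixed unitary.  Since U(D) is compact,    *)
(* the law of a random unitary is determined by all its polynomial moments *)
(* in the entries and their conjugates, so invariance of the law is        *)
(* expressed as invariance of every such moment.                           *)
Definition haar_ensemble (R : realType) (dT : measure_display)
  (T : measurableType dT) (P : probability T R) (D : nat)
  (U : T -> 'M[R[i]]_D) : Prop :=
  unitary_ensemble P U /\
  forall (V : 'M[R[i]]_D), V \is unitarymx ->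
  forall (p q : nat) (i j : 'I_p -> 'I_D) (k l : 'I_q -> 'I_D),
    Ec P (fun x => monomial i j k l (V *m U x)) = Ec P (fun x => monomial i j k l (U x)) /\
    Ec P (fun x => monomial i j k l (U x *m V)) = Ec P (fun x => monomial i j k l (U x)).

(* Unitary t-design: the t-th moments E[U^{(x)t} X U^{dagger (x)t}], i.e.  *)
(* all moments of degree (t,t) in the entries of U and their conjugates,   *)
(* coincide with those of the Haar measure.                                 *)
Definition unitary_design (R : realType) (t : nat) (dT : measure_display)
  (T : measurableType dT) (P : probability T R) (D : nat)
  (U : T -> 'M[R[i]]_D) : Prop :=
  unitary_ensemble P U /\
  exists (dH : measure_display) (TH : measurableType dH)
         (PH : probability TH R) (UH : TH -> 'M[R[i]]_D),
    haar_ensemble PH UH /\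
    forall (i j k l : 'I_t -> 'I_D),
      Ec P (fun x => monomial i j k l (U x)) = Ec PH (fun x => monomial i j k l (UH x)).

(* Measurement channel  M(X) = E_U sum_b <b|U X U^dag|b> U^dag |b><b| U.   *)
Definition meas_channel (R : realType) (dT : measure_display)
  (T : measurableType dT) (P : probability T R) (D : nat)
  (U : T -> 'M[R[i]]_D) (X : 'M[R[i]]_D) : 'M[R[i]]_D :=
  \sum_(b < D) Emx P (fun t => (U t *m X *m (U t)^t*) b b *: ((U t)^t* *m delta_mx b b *m U t)).

(* Minv is the inverse of the measurement channel. *)
Definition channel_inverse (R : realType) (dT : measure_display)
  (T : measurableType dT) (P : probability T R) (D : nat)
  (U : T -> 'M[R[i]]_D) (Minv : 'M[R[i]]_D -> 'M[R[i]]_D) : Prop :=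
  forall X, meas_channel P U (Minv X) = X /\ Minv (meas_channel P U X) = X.

(* V_*(O, rho) =
     E_U ( sum_b <b|U rho U^dag|b> <b|U M^{-1}(O) U^dag|b> )^2 - tr(O rho)^2. *)
Definition Vstar_rho (R : realType) (dT : measure_display)
  (T : measurableType dT) (P : probability T R) (D : nat)
  (U : T -> 'M[R[i]]_D) (Minv : 'M[R[i]]_D -> 'M[R[i]]_D)
  (O rho : 'M[R[i]]_D) : R[i] :=
  Ec P (fun t => (\sum_(b < D) (U t *m rho *m (U t)^t*) b b
                               * (U t *m Minv O *m (U t)^t*) b b) ^+ 2)
  - (\tr (O *m rho)) ^+ 2.

Definition is_hermitian (C : numClosedFieldType) (D : nat) (A : 'M[C]_D) : Prop :=
  A^t* = A.

(* density operator: Hermitian, positive semidefinite, unit trace *)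
Definition density (C : numClosedFieldType) (D : nat) (rho : 'M[C]_D) : Prop :=
  is_hermitian rho /\ (forall v : 'cV[C]_D, 0 <= (v^t* *m rho *m v) 0 0) /\ \tr rho = 1.

(* pure state: unit vector *)
Definition unit_vector (C : numClosedFieldType) (D : nat) (phi : 'cV[C]_D) : Prop :=
  (phi^t* *m phi) 0 0 = 1.

(* conjugate transpose and squared Hilbert-Schmidt norm *)
Definition adj (C : numClosedFieldType) (m k : nat) (A : 'M[C]_(m, k)) : 'M[C]_(k, m) :=
  A^t*.

Definition hs_norm2 (C : numClosedFieldType) (D : nat) (A : 'M[C]_D) : C :=
  \tr (A *m adj A).

(* Main.v *)
Require Import Defs.
From mathcomp Require Import all_boot all_order all_algebra.
From mathcomp Require Import all_classical all_reals all_analysis.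
From mathcomp Require Import measurable_realfun complex spectral.
From mathcomp Require Import ring.
Import Order.TTheory GRing.Theory Num.Theory.
Local Open Scope ring_scope.
Local Open Scope sesquilinear_scope.

(** The variance is a moment of degree (4,4), so it may be computed for the
    Haar measure.  Write [A^] for [U A U^*].  Invariance under the unitaries
    [((1 - t^2) + 2 i t H) / (1 + t^2)], with [H] a Hermitian involution, makes
    the expectation of a product of entries of [A_1^, ..., A_k^] constant in
    [t]; the coefficient of [t] gives the Ward identity
    [E (D_X (product)) = 0], where [D_X A^ = X A^ - A^ X].  By linearity [X] may
    be any elementary matrix [E_pq].  Taking [X = E_mb] and summing over
    [m <> b] yields
      [(d + k) E (A_bb^ B1_bb^ ... Bk_bb^)
       = tr A E (B1_bb^ ... Bk_bb^) + sum_i E (... (Bi A)_bb^ ...)],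
    and a similar sum over two distinct rows reduces the mixed moments
    [E (A_bb^ B_bb^ F_cc^ G_cc^)] to single row moments.  Hence
    [M (X) = (X + tr X) / (d + 1)] and
      [d V = r^2 + (d+1) (((d+2) l - 1) q - 2 r^2 - 4 s + (2d+2) z - 2 k)
             / ((d+2) (d+3))]
    with [r = tr (rho O)], [q = tr O^2], [s = tr (rho O^2)], [l = tr rho^2],
    [z = tr (rho^2 O^2)], [k = tr (rho O rho O)].  In an eigenbasis of [rho] one
    sees that [0 <= k], [r^2 <= s <= q], [z <= s] and [l <= 1], which gives the
    bound.  For [O = |phi><phi| - 1/d] the variance becomes a polynomial in [l],
    [f = <phi|rho|phi>] and [g = <phi|rho^2|phi>] that is maximal at
    [l = f = g = 1]. *)

(** * Bounded measurable random variables and linearity of the complex expectation *)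

Section BoundedMeasurable.
Context {R : realType} {dT : measure_display} {T : measurableType dT}.
Implicit Types (g h : T -> R) (f : T -> R[i]).

(** Boundedness is used instead of integrability because it is stable under products. Entries of a
    unitary have modulus at most 1, so all polynomials in them and their conjugates stay in this
    class. *)
Definition bmeas g :=
  measurable_fun setT g /\ exists M : R, forall t, `|g t| <= M.

Definition bmeasC f :=
  bmeas (fun t => complex.Re (f t)) /\ bmeas (fun t => complex.Im (f t)).

Lemma bmeas_cst (a : R) : bmeas (fun=> a).
Proof. by split; [exact: measurable_cst | exists `|a|]. Qed.

Lemma bmeasD g h : bmeas g -> bmeas h -> bmeas (fun t => g t + h t).
Proof.
move=> [mg [M gM]] [mh [N hN]]; split; first exact: measurable_funD.
by exists (M + N) => t; apply: le_trans (ler_normD _ _) (lerD _ _).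
Qed.

Lemma bmeasM g h : bmeas g -> bmeas h -> bmeas (fun t => g t * h t).
Proof.
move=> [mg [M gM]] [mh [N hN]]; split; first exact: measurable_funM.
by exists (M * N) => t; rewrite normrM ler_pM.
Qed.

Lemma bmeasN g : bmeas g -> bmeas (fun t => - g t).
Proof.
move=> bg; have -> : (fun t => - g t) = (fun t => -1 * g t).
  by apply: funext => t; rewrite mulN1r.
exact: bmeasM (bmeas_cst _) bg.
Qed.

Lemma bmeasC_cst (a : R[i]) : bmeasC (fun=> a).
Proof. by split; exact: bmeas_cst. Qed.

Lemma bmeasCD f1 f2 : bmeasC f1 -> bmeasC f2 -> bmeasC (fun t => f1 t + f2 t).
Proof.
move=> [r1 i1] [r2 i2]; split.
  rewrite (_ : (fun t => _) = (fun t => complex.Re (f1 t) + complex.Re (f2 t))).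
    exact: bmeasD.
  by apply: funext => t; case: (f1 t) (f2 t) => [? ?] [? ?].
rewrite (_ : (fun t => _) = (fun t => complex.Im (f1 t) + complex.Im (f2 t))).
  exact: bmeasD.
by apply: funext => t; case: (f1 t) (f2 t) => [? ?] [? ?].
Qed.

Lemma bmeasCM f1 f2 : bmeasC f1 -> bmeasC f2 -> bmeasC (fun t => f1 t * f2 t).
Proof.
move=> [r1 i1] [r2 i2]; split.
  rewrite (_ : (fun t => _) = (fun t => complex.Re (f1 t) * complex.Re (f2 t)
      + - (complex.Im (f1 t) * complex.Im (f2 t)))).
    by apply: bmeasD; [exact: bmeasM | apply: bmeasN; exact: bmeasM].
  by apply: funext => t; case: (f1 t) (f2 t) => [? ?] [? ?].
rewrite (_ : (fun t => _) = (fun t => complex.Re (f1 t) * complex.Im (f2 t)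
      + complex.Im (f1 t) * complex.Re (f2 t))).
  by apply: bmeasD; exact: bmeasM.
by apply: funext => t; case: (f1 t) (f2 t) => [? ?] [? ?].
Qed.

Lemma bmeasCZ (a : R[i]) f : bmeasC f -> bmeasC (fun t => a * f t).
Proof. by move=> bf; exact: bmeasCM (bmeasC_cst _) bf. Qed.

Lemma bmeasCN f : bmeasC f -> bmeasC (fun t => - f t).
Proof. by move=> bf; under eq_fun do rewrite -mulN1r; exact: bmeasCZ. Qed.

Lemma bmeasCB f1 f2 : bmeasC f1 -> bmeasC f2 -> bmeasC (fun t => f1 t - f2 t).
Proof. by move=> b1 b2; exact: bmeasCD b1 (bmeasCN _ b2). Qed.

Lemma bmeasC_conj f : bmeasC f -> bmeasC (fun t => (f t)^*).
Proof.
move=> [r1 i1]; split.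
  rewrite (_ : (fun t => _) = (fun t => complex.Re (f t))) //.
  by apply: funext => t; case: (f t).
rewrite (_ : (fun t => _) = (fun t => - complex.Im (f t))).
  exact: bmeasN.
by apply: funext => t; case: (f t).
Qed.

Lemma bmeasC_sum (I : Type) (s : seq I) (p : pred I) (F : I -> T -> R[i]) :
  (forall i, p i -> bmeasC (F i)) -> bmeasC (fun t => \sum_(i <- s | p i) F i t).
Proof.
move=> bF; elim: s => [|i s IHs].
  by under eq_fun do rewrite big_nil; exact: bmeasC_cst.
under eq_fun do rewrite big_cons.
case: (boolP (p i)) => // pi; exact: bmeasCD (bF _ pi) IHs.
Qed.

Lemma bmeasC_prod (I : Type) (s : seq I) (F : I -> T -> R[i]) :
  (forall i, bmeasC (F i)) -> bmeasC (fun t => \prod_(i <- s) F i t).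
Proof.
move=> bF; elim: s => [|i s IHs].
  by under eq_fun do rewrite big_nil; exact: bmeasC_cst.
under eq_fun do rewrite big_cons; exact: bmeasCM.
Qed.

Variable P : probability T R.

Lemma bmeas_integrable g : bmeas g -> P.-integrable setT (EFin \o g).
Proof.
move=> [mg [M gM]]; apply: measurable_bounded_integrable => //.
  by rewrite ltey_eq fin_num_measure.
exists M; split; first exact: num_real.
by move=> x Mx t _; exact: le_trans (gM t) (ltW Mx).
Qed.

Lemma EcD f1 f2 : bmeasC f1 -> bmeasC f2 ->
  Ec P (fun t => f1 t + f2 t) = Ec P f1 + Ec P f2.
Proof.
move=> [r1 i1] [r2 i2]; rewrite /Ec.
rewrite (_ : (fun t => complex.Re _) =
    (fun t => complex.Re (f1 t) + complex.Re (f2 t))); last first.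
  by apply: funext => t; case: (f1 t) (f2 t) => [? ?] [? ?].
rewrite (_ : (fun t => complex.Im _) =
    (fun t => complex.Im (f1 t) + complex.Im (f2 t))); last first.
  by apply: funext => t; case: (f1 t) (f2 t) => [? ?] [? ?].
by rewrite !RintegralD //; exact: bmeas_integrable.
Qed.

Lemma EcZ (a : R[i]) f : bmeasC f -> Ec P (fun t => a * f t) = a * Ec P f.
Proof.
case: a => a b [r1 i1]; rewrite /Ec.
rewrite (_ : (fun t => complex.Re _) =
    (fun t => a * complex.Re (f t) - b * complex.Im (f t))); last first.
  by apply: funext => t; case: (f t).
rewrite (_ : (fun t => complex.Im _) =
    (fun t => a * complex.Im (f t) + b * complex.Re (f t))); last first.
  by apply: funext => t; case: (f t).
have iM c g : bmeas g -> P.-integrable setT (EFin \o (fun t => c * g t)).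
  by move=> bg; apply: bmeas_integrable; exact: bmeasM (bmeas_cst _) bg.
rewrite RintegralB ?RintegralD ?RintegralZl //; do ?exact: iM;
  exact: bmeas_integrable.
Qed.

Lemma Ec_cst (a : R[i]) : Ec P (fun=> a) = a.
Proof.
case: a => a b; rewrite /Ec !Rintegral_cst //=.
have -> : fine (P [set: T]%classic) = 1 by rewrite probability_setT.
by rewrite !mulr1.
Qed.

Lemma EcN f : bmeasC f -> Ec P (fun t => - f t) = - Ec P f.
Proof.
move=> bf; under eq_fun do rewrite -mulN1r.
by rewrite EcZ // mulN1r.
Qed.

Lemma EcB f1 f2 : bmeasC f1 -> bmeasC f2 ->
  Ec P (fun t => f1 t - f2 t) = Ec P f1 - Ec P f2.
Proof.
by move=> b1 b2; rewrite EcD ?EcN //; exact: bmeasCN.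
Qed.

Lemma Ec_sum (I : Type) (s : seq I) (p : pred I) (F : I -> T -> R[i]) :
  (forall i, p i -> bmeasC (F i)) ->
  Ec P (fun t => \sum_(i <- s | p i) F i t) = \sum_(i <- s | p i) Ec P (F i).
Proof.
move=> bF; elim: s => [|i s IHs].
  by under eq_fun do rewrite big_nil; rewrite Ec_cst big_nil.
rewrite big_cons -IHs; under eq_fun do rewrite big_cons.
case: (boolP (p i)) => // pi; rewrite EcD //; [exact: bF | exact: bmeasC_sum].
Qed.

End BoundedMeasurable.

(** * The Leibniz rule for products over lists *)

Section Leibniz.
Context {K : comNzRingType} {X : Type}.
Implicit Types (v D : X -> K) (s : seq X).

(** The value on the product of the [v x] of a derivation sending [v x] to [D x]: one factor at a
    time is replaced. [D] is any function, so that linearity in [D] can be exploited. *)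
Fixpoint leibniz v D s : K :=
  if s is x :: s' then D x * \prod_(y <- s') v y + v x * leibniz v D s' else 0.

Lemma eq_leibniz v D D' s : D =1 D' -> leibniz v D s = leibniz v D' s.
Proof. by move=> eD; elim: s => //= x s ->; rewrite eD. Qed.

Lemma leibnizZ v D a s :
  leibniz v (fun x => a * D x) s = a * leibniz v D s.
Proof. by elim: s => /= [|x s ->]; [rewrite mulr0 | ring]. Qed.

Lemma leibnizD v D1 D2 s :
  leibniz v (fun x => D1 x + D2 x) s = leibniz v D1 s + leibniz v D2 s.
Proof. by elim: s => /= [|x s ->]; rewrite ?addr0 //; ring. Qed.

(** Euler's identity for a monomial; it produces the shift by [size L] in [row_recursion]. *)
Lemma leibniz_id v s : leibniz v v s = (size s)%:R * \prod_(x <- s) v x.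
Proof.
by elim: s => /= [|x s ->]; rewrite ?mul0r // big_cons -natr1; ring.
Qed.

Lemma leibniz_sum v (I : Type) (r : seq I) (p : pred I) (D : I -> X -> K) s :
  \sum_(i <- r | p i) leibniz v (D i) s =
  leibniz v (fun x => \sum_(i <- r | p i) D i x) s.
Proof.
elim: s => [|x s IHs] /=; first by rewrite big1.
by rewrite big_split /= -mulr_suml -mulr_sumr IHs.
Qed.

Lemma coef0_prod (F : X -> {poly K}) s :
  (\prod_(x <- s) F x)`_0 = \prod_(x <- s) (F x)`_0.
Proof.
elim: s => [|x s IHs]; first by rewrite !big_nil coef1.
by rewrite !big_cons coef0M IHs.
Qed.

(** The linear coefficient is the derivative at 0, hence obeys the Leibniz rule. *)
Lemma coef1_prod (F : X -> {poly K}) s :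
  (\prod_(x <- s) F x)`_1 = leibniz (fun x => (F x)`_0) (fun x => (F x)`_1) s.
Proof.
elim: s => [|x s IHs] /=; first by rewrite big_nil coef1.
rewrite big_cons coefM 2!big_ord_recl big_ord0 /= coef0_prod IHs.
by rewrite addr0 addrC.
Qed.

End Leibniz.

Lemma leibniz_map (K : comNzRingType) (I J : Type) (f : I -> J) (v D : J -> K) s :
  leibniz v D (map f s) = leibniz (v \o f) (D \o f) s.
Proof. by elim: s => //= x s ->; rewrite big_map. Qed.

(** * Entries of conjugated matrices, their moments, and Cayley unitaries *)

Section Twirl.
Context {R : realType} {D : nat}.
Local Notation C := R[i].
Local Notation factor := ('M[C]_D * ('I_D * 'I_D))%type.
Implicit Types (x : factor) (s : seq factor) (V U X A B : 'M[C]_D).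

(** Conjugation by one fixed unitary; no average is taken here. *)
Definition twirl U A : 'M[C]_D := U *m A *m U^t*.

(** A factor [(A, (i, j))] stands for one entry of the conjugated matrix, so a list of factors
    encodes a product of entries of several such matrices. *)
Definition entry U x : C := twirl U x.1 x.2.1 x.2.2.

(** The derivative at time 0 of the entry when [U] is replaced by [exp (t X) U] and the inverse
    exponential acts on the right of the conjugated matrix. *)
Definition comm_entry X U x : C :=
  (X *m twirl U x.1 - twirl U x.1 *m X) x.2.1 x.2.2.

Lemma entry_sum U x : entry U x =
  \sum_(jk : 'I_D * 'I_D) x.1 jk.1 jk.2 * (U x.2.1 jk.1 * (U x.2.2 jk.2)^*).
Proof.
rewrite /entry /twirl mxE.
rewrite -(pair_bigA _ (fun j k => x.1 j k * (U x.2.1 j * (U x.2.2 k)^*))) /=.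
rewrite exchange_big /=.
apply: eq_bigr => k _; rewrite mxE mulr_suml; apply: eq_bigr => j _.
by rewrite !mxE mulrA (mulrC (x.1 j k)).
Qed.

(** This reduces products of [t] entries to monomials of degree [(t, t)], in terms of which Haar
    invariance and the design property are stated. *)
Lemma prod_entry_monomial U t (x : 'I_t -> factor) :
  \prod_(a < t) entry U (x a) =
  \sum_(f : {ffun 'I_t -> 'I_D * 'I_D})
     (\prod_(a < t) (x a).1 (f a).1 (f a).2) *
     monomial (fun a => (x a).2.1) (fun a => (f a).1)
              (fun a => (x a).2.2) (fun a => (f a).2) U.
Proof.
under eq_bigr do rewrite entry_sum.
rewrite bigA_distr_bigA /=; apply: eq_bigr => f _.
by rewrite /monomial !big_split.
Qed.

Lemma unitarymx_mul (U : 'M[C]_D) : U \is unitarymx -> U *m U^t* = 1%:M.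
Proof. by move/unitarymxP. Qed.

Lemma unitarymx_mulV (U : 'M[C]_D) : U \is unitarymx -> U^t* *m U = 1%:M.
Proof. by move=> uU; apply: mulmx1C; exact: unitarymx_mul. Qed.

Lemma trmxC_mul m n p (A : 'M[C]_(m, n)) (B : 'M[C]_(n, p)) :
  (A *m B)^t* = B^t* *m A^t*.
Proof. by rewrite trmx_mul map_mxM. Qed.

Lemma twirl_mul V U A : twirl (V *m U) A = twirl V (twirl U A).
Proof. by rewrite /twirl trmxC_mul !mulmxA. Qed.

Lemma mulmx_twirl U A B : U \is unitarymx ->
  twirl U A *m twirl U B = twirl U (A *m B).
Proof.
move=> uU; rewrite /twirl !mulmxA; congr (_ *m _ *m _).
by rewrite -!mulmxA unitarymx_mulV // mulmx1.
Qed.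

Lemma mxtrace_twirl U A : U \is unitarymx -> \tr (twirl U A) = \tr A.
Proof.
by move=> uU; rewrite /twirl mxtrace_mulC mulmxA unitarymx_mulV // mul1mx.
Qed.

Section Ensemble.
Context {dT : measure_display} {T : measurableType dT} {P : probability T R}.
Context {U : T -> 'M[C]_D}.
Hypothesis ensU : unitary_ensemble P U.

Lemma bmeasC_unitary_entry i j : bmeasC (fun t => U t i j).
Proof.
have [uU mU] := ensU; have [mr mi] := mU i j.
(* Row [i] of a unitary has norm 1, so each of its entries lies in the unit disc. *)
have le1 t : complex.Re (U t i j) ^+ 2 + complex.Im (U t i j) ^+ 2 <= 1.
  have /matrixP/(_ i i) := unitarymx_mul _ (uU t).
  rewrite !mxE eqxx mulr1n (bigD1 j) //= !mxE => e1.
  have : (complex.Re (U t i j) ^+ 2 + complex.Im (U t i j) ^+ 2)%:C%C <= 1 :> C.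
    rewrite add_Re2_Im2 normCK -e1 lerDl; apply: sumr_ge0 => k _.
    by rewrite !mxE mul_conjC_ge0.
  by rewrite lecR.
by split; split => //; exists 1 => t; rewrite -[_ <= 1]ler_sqr ?nnegrE //
  expr1n real_normK ?num_real //; apply: le_trans (le1 t);
  rewrite ?lerDl ?lerDr sqr_ge0.
Qed.

Lemma bmeasC_mulmx (m n p : nat) (F : T -> 'M[C]_(m, n)) (G : T -> 'M[C]_(n, p)) :
  (forall i j, bmeasC (fun t => F t i j)) ->
  (forall i j, bmeasC (fun t => G t i j)) ->
  forall i j, bmeasC (fun t => (F t *m G t) i j).
Proof.
move=> bF bG i j; under eq_fun do rewrite mxE.
by apply: bmeasC_sum => k _; exact: bmeasCM.
Qed.

Lemma bmeasC_twirl A i j : bmeasC (fun t => twirl (U t) A i j).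
Proof.
apply: bmeasC_mulmx => [i' j'|i' j'].
  apply: bmeasC_mulmx => [|i'' j'']; first exact: bmeasC_unitary_entry.
  exact: bmeasC_cst.
under eq_fun do rewrite !mxE.
by apply: bmeasC_conj; exact: bmeasC_unitary_entry.
Qed.

Lemma bmeasC_comm_entry X x : bmeasC (fun t => comm_entry X (U t) x).
Proof.
rewrite /comm_entry; under eq_fun do rewrite !mxE.
apply: bmeasCB.
  by apply: bmeasC_sum => k _; apply: bmeasCZ; exact: bmeasC_twirl.
apply: bmeasC_sum => k _; apply: bmeasCM; last exact: bmeasC_cst.
exact: bmeasC_twirl.
Qed.

Lemma bmeasC_leibniz (I : Type) (v d : T -> I -> C) (r : seq I) :
  (forall i, bmeasC (fun t => v t i)) -> (forall i, bmeasC (fun t => d t i)) ->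
  bmeasC (fun t => leibniz (v t) (d t) r).
Proof.
move=> bv bd; elim: r => /= [|i r IHr]; first exact: bmeasC_cst.
apply: bmeasCD; last exact: bmeasCM.
by apply: bmeasCM => //; exact: bmeasC_prod.
Qed.

Lemma Ec_prod_entry t (x : 'I_t -> factor) :
  Ec P (fun w => \prod_(a < t) entry (U w) (x a)) =
  \sum_(f : {ffun 'I_t -> 'I_D * 'I_D})
     (\prod_(a < t) (x a).1 (f a).1 (f a).2) *
     Ec P (fun w => monomial (fun a => (x a).2.1) (fun a => (f a).1)
              (fun a => (x a).2.2) (fun a => (f a).2) (U w)).
Proof.
under eq_fun do rewrite prod_entry_monomial.
have bm (f : {ffun 'I_t -> 'I_D * 'I_D}) : bmeasC (fun w =>
    monomial (fun a => (x a).2.1) (fun a => (f a).1)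
             (fun a => (x a).2.2) (fun a => (f a).2) (U w)).
  apply: bmeasCM; apply: bmeasC_prod => a; first exact: bmeasC_unitary_entry.
  by apply: bmeasC_conj; exact: bmeasC_unitary_entry.
by rewrite Ec_sum => [|f _]; [apply: eq_bigr => f _; rewrite EcZ | exact: bmeasCZ].
Qed.

End Ensemble.

(** A nonzero difference would have too many roots. It therefore suffices to use Cayley unitaries at
    natural parameters. *)
Lemma poly_eq_nat (p q : {poly C}) :
  (forall k : nat, p.[k%:R] = q.[k%:R]) -> p = q.
Proof.
move=> epq; apply/eqP; rewrite -subr_eq0; apply/eqP.
apply: (@roots_geq_poly_eq0 _ _ [seq k%:R | k <- iota 0 (size (p - q))]).
- by apply/allP => _ /mapP[k _ ->]; rewrite /root hornerD hornerN epq subrr.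
- rewrite map_inj_uniq ?iota_uniq // => i j /eqP.
  by rewrite eqr_nat => /eqP.
- by rewrite size_map size_iota.
Qed.

(* (1 + X^2)^2 times the entry of the twirl by V_X U, where
   V_X = ((1 - X^2) + 2 i X H) / (1 + X^2) is unitary for real X
   when H is a Hermitian involution. *)
Definition cayley_entry H V x : {poly C} :=
  entry V x *: (1 - 'X^2) ^+ 2
  + (2 * 'i * comm_entry H V x) *: ('X * (1 - 'X^2))
  + (4 * (H *m twirl V x.1 *m H) x.2.1 x.2.2) *: 'X^2.

Lemma cayley_entry0 H V x : (cayley_entry H V x)`_0 = entry V x.
Proof.
rewrite -horner_coef0 /cayley_entry !hornerE /=; ring.
Qed.

Lemma cayley_entry1 H V x :
  (cayley_entry H V x)`_1 = 2 * 'i * comm_entry H V x.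
Proof.
have coef1E (p : {poly C}) : p`_1 = p^`().[0].
  by rewrite horner_coef0 coef_deriv.
rewrite coef1E /cayley_entry.
rewrite !(derivD, derivZ, derivM, derivN, derivXn, derivX, derivC, expr2).
generalize (comm_entry H V x) (entry V x) ((H *m twirl V x.1 *m H) x.2.1 x.2.2).
by move=> *; rewrite !hornerE /=; ring.
Qed.

(** A degree bound independent of [V]: it bounds the number of coefficients uniformly, so that
    expectations can be taken coefficientwise. *)
Lemma size_cayley_entry H V x : (size (cayley_entry H V x) <= 5)%N.
Proof.
apply/leq_sizeP => j hj; rewrite /cayley_entry.
have -> : (1 - 'X^2) ^+ 2 = 1 - 2%:P * 'X^2 + 'X^4 :> {poly C}.
  by rewrite polyCD; ring.
have -> : 'X * (1 - 'X^2) = 'X - 'X^3 :> {poly C} by ring.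
rewrite !(coefD, coefZ, coefN, coefXn, coefCM, coef1, coefX).
by move: j hj => [|[|[|[|[|j]]]]] //= _; ring.
Qed.

(** For a Hermitian involution [H] this is the Cayley transform [(1 + i k H) / (1 - i k H)], since
    [(1 + i k H)^2 = 1 - k^2 + 2 i k H]. *)
Definition cayley H (k : nat) : 'M[C]_D :=
  ((1 - k%:R ^+ 2) / (1 + k%:R ^+ 2))%:M + (2 * 'i * k%:R / (1 + k%:R ^+ 2)) *: H.

Lemma cayley_denom_neq0 (k : nat) : 1 + k%:R ^+ 2 != 0 :> C.
Proof. by rewrite gt_eqF // ltr_wpDr // exprn_ge0 // ler0n. Qed.

Lemma cayley_trmxC H k : H^t* = H -> (cayley H k)^t* =
  ((1 - k%:R ^+ 2) / (1 + k%:R ^+ 2))%:M - (2 * 'i * k%:R / (1 + k%:R ^+ 2)) *: H.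
Proof.
move=> hermH; rewrite /cayley; set a := (1 - _) / _; set b := 2 * _ * _ / _.
have ca : a^* = a by rewrite /a fmorph_div !rmorphE /= ?conjC_nat.
have cb : b^* = - b.
  by rewrite /b fmorph_div !rmorphE /= 2!rmorphM /= conjCi !conjC_nat mulrN !mulNr.
apply/matrixP => i j; have hH : (H j i)^* = H i j by rewrite -{2}hermH !mxE.
by rewrite !mxE rmorphD rmorphMn rmorphM /= hH ca cb eq_sym mulNr.
Qed.

Lemma twirl_cayley H k A : H^t* = H ->
  (1 + k%:R ^+ 2) ^+ 2 *: twirl (cayley H k) A =
  (1 - k%:R ^+ 2) ^+ 2 *: A
  + (2 * 'i * (k%:R * (1 - k%:R ^+ 2))) *: (H *m A - A *m H)
  + (4 * k%:R ^+ 2) *: (H *m A *m H).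
Proof.
move=> hermH; rewrite /twirl cayley_trmxC // /cayley.
set a := _ / _; set b := _ / _.
have -> : (a%:M + b *: H) *m A *m (a%:M - b *: H) =
    a ^+ 2 *: A + (a * b) *: (H *m A - A *m H) - b ^+ 2 *: (H *m A *m H).
  rewrite mulmxBr mulmxDl mul_scalar_mx mul_mx_scalar -scalemxAl -!scalemxAr.
  rewrite mulmxDl -!scalemxAl; apply/matrixP => i j; rewrite !mxE; ring.
apply/matrixP => i j; rewrite !mxE /a /b.
have := cayley_denom_neq0 k; move: (k%:R : C) => u u0.
have i2 : 'i ^+ 2 = -1 :> C by exact: sqrCi.
by field: i2.
Qed.

Lemma cayley_unitary H k : H *m H = 1%:M -> H^t* = H -> cayley H k \is unitarymx.
Proof.
move=> HH hermH; apply/unitarymxP.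
have : (1 + k%:R ^+ 2) ^+ 2 *: (cayley H k *m (cayley H k)^t*) =
    (1 + k%:R ^+ 2) ^+ 2 *: 1%:M.
  (* At [A = 1] the commutator vanishes, and [(1 - k^2)^2 + 4 k^2 = (1 + k^2)^2]. *)
  have := twirl_cayley H k 1%:M hermH; rewrite /twirl !mulmx1 mul1mx HH => ->.
  by rewrite subrr scaler0 addr0 -scalerDl; congr (_ *: _); ring.
by apply: scalerI; rewrite expf_neq0 // cayley_denom_neq0.
Qed.

Lemma horner_cayley_entry H V x (k : nat) : H^t* = H ->
  (cayley_entry H V x).[k%:R] = (1 + k%:R ^+ 2) ^+ 2 * entry (cayley H k *m V) x.
Proof.
move=> hermH; rewrite /cayley_entry /comm_entry /entry twirl_mul.
move: (twirl_cayley H k (twirl V x.1) hermH); move: (twirl V x.1) => A.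
move: (twirl (cayley H k) A) (H *m A - A *m H) (H *m A *m H) => B M N.
by move/matrixP/(_ x.2.1 x.2.2); rewrite !mxE !hornerE /= => ->; ring.
Qed.

(** * Ward identities of the Haar measure *)

Section Haar.
Context {dT : measure_display} {T : measurableType dT} {P : probability T R}.
Context {U : T -> 'M[C]_D}.
Hypothesis haarU : haar_ensemble P U.
Let ensU : unitary_ensemble P U := proj1 haarU.

(** Both sides expand into the same combination of moments, which left invariance identifies term by
    term. *)
Lemma haar_prod_entry V s : V \is unitarymx ->
  Ec P (fun w => \prod_(x <- s) entry (V *m U w) x) =
  Ec P (fun w => \prod_(x <- s) entry (U w) x).
Proof.
move=> uV.
have ensVU : unitary_ensemble P (fun w => V *m U w).
  split=> [w|i j]; first exact: mul_unitarymx uV (proj1 ensU w).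
  have [[mr _] [mi _]] := bmeasC_mulmx _ _ _ (fun=> V) U
    (fun i j => bmeasC_cst _) (bmeasC_unitary_entry ensU) i j.
  by split.
have tnthE (W : T -> 'M[C]_D) : (fun w => \prod_(x <- s) entry (W w) x) =
    (fun w => \prod_(a < size s) entry (W w) (tnth (in_tuple s) a)).
  by apply: funext => w; rewrite big_tnth.
rewrite (tnthE U) (tnthE (fun w => V *m U w)) (Ec_prod_entry ensVU) (Ec_prod_entry ensU).
by apply: eq_bigr => f _; rewrite (proj1 (proj2 haarU _ uV _ _ _ _ _ _)).
Qed.

(** By invariance the expected product of the Cayley polynomials equals [e (1 + X^2)^(2 |s|)], with
    [e] the expectation at time 0. This has no linear term, whereas the linear coefficient of the
    product is [2 i] times the Leibniz sum. *)
Lemma ward_involution H s : H *m H = 1%:M -> H^t* = H ->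
  Ec P (fun w => leibniz (entry (U w)) (comm_entry H (U w)) s) = 0.
Proof.
move=> HH hermH.
pose Q w := \prod_(x <- s) cayley_entry H (U w) x.
(* Each factor has size at most 5; the extra 2 keeps index 1 in range even when [s] is empty. *)
pose N := (5 * size s + 2)%N.
have sQ w : (size (Q w) <= N)%N.
  rewrite /Q /N; elim: (s) => [|x r IHr]; first by rewrite big_nil size_poly1.
  rewrite big_cons /=; apply: leq_trans (size_polyMleq _ _) _.
  apply: leq_trans (leq_pred _) _; rewrite mulnS -addnA.
  exact: leq_add (size_cayley_entry H (U w) x) IHr.
have bE x : bmeasC (fun w => entry (U w) x) by exact: (bmeasC_twirl ensU).
have bQ j : bmeasC (fun w => (Q w)`_j).
  rewrite /Q; elim: (s) j => [|x r IHr] j.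
    by under eq_fun do rewrite big_nil; exact: bmeasC_cst.
  under eq_fun do rewrite big_cons coefM.
  apply: bmeasC_sum => i _; apply: bmeasCM => //.
  rewrite /cayley_entry; under eq_fun do rewrite !coefD !coefZ.
  apply: bmeasCD; last first.
    apply: bmeasCM (bmeasC_cst _); apply: bmeasCZ.
    apply: bmeasC_mulmx => [i' j'|? ?]; last exact: bmeasC_cst.
    by apply: bmeasC_mulmx => [? ?|? ?]; [exact: bmeasC_cst|exact: (bmeasC_twirl ensU)].
  apply: bmeasCD; first exact: bmeasCM (bmeasC_cst _).
  by apply: bmeasCM (bmeasC_cst _); apply: bmeasCZ; exact: (bmeasC_comm_entry ensU).
have bL : bmeasC (fun w => leibniz (entry (U w)) (comm_entry H (U w)) s).
  by apply: bmeasC_leibniz => // x; exact: (bmeasC_comm_entry ensU).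
set e := Ec P (fun w => \prod_(x <- s) entry (U w) x).
(* The expectation of the random polynomial [Q], taken coefficient by coefficient. *)
pose q := \poly_(i < N) Ec P (fun w => (Q w)`_i).
have qE : q = e *: (1 + 'X^2) ^+ (2 * size s).
  apply: poly_eq_nat => k; rewrite /q horner_poly.
  under eq_bigr => i _ do rewrite mulrC -EcZ //.
  rewrite -Ec_sum; last by move=> i _; exact: bmeasCZ.
  have -> : (fun w => \sum_(i < N) k%:R ^+ i * (Q w)`_i) = (fun w =>
      (1 + k%:R ^+ 2) ^+ (2 * size s) *
      \prod_(x <- s) entry (cayley H k *m U w) x).
    apply: funext => w; transitivity (Q w).[k%:R].
      by rewrite (horner_coef_wide _ (sQ w)); apply: eq_bigr => i _; rewrite mulrC.
    rewrite /Q horner_prod; under eq_bigr do rewrite horner_cayley_entry //.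
    by rewrite big_split /= big_const_seq count_predT iter_mulr_1 -exprM.
  have uc : cayley H k \is unitarymx by exact: cayley_unitary.
  rewrite EcZ; last first.
    under eq_fun do under eq_bigr do rewrite /entry twirl_mul /twirl.
    apply: bmeasC_prod => x; apply: bmeasC_mulmx => [? ?|? ?]; last exact: bmeasC_cst.
    by apply: bmeasC_mulmx => [? ?|? ?]; [exact: bmeasC_cst|exact: (bmeasC_twirl ensU)].
  by rewrite haar_prod_entry // !hornerE mulrC.
have := congr1 (fun p : {poly C} => p`_1) qE.
rewrite coef_poly coefZ ifT; last by rewrite /N addn2.
have -> : ((1 + 'X^2) ^+ (2 * size s) : {poly C})`_1 = 0.
  elim: (2 * size s)%N => [|m IHm]; first by rewrite expr0 coef1.
  by rewrite exprS mulrDl mul1r coefD IHm coefXnM addr0.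
under eq_fun do rewrite /Q coef1_prod.
have -> : (fun w => leibniz (fun x => (cayley_entry H (U w) x)`_0)
    (fun x => (cayley_entry H (U w) x)`_1) s) =
    (fun w => 2 * 'i * leibniz (entry (U w)) (comm_entry H (U w)) s).
  apply: funext => w; rewrite -leibnizZ; congr leibniz; apply: funext => x.
    exact: cayley_entry0.
  exact: cayley_entry1.
rewrite EcZ // mulr0 => /eqP; rewrite !mulf_eq0 pnatr_eq0 /=.
by rewrite (negPf (neq0Ci _)) /= => /eqP.
Qed.

End Haar.
End Twirl.

(** * Ward identities along elementary matrices and moments of a single row *)

Section Moments.
Context {R : realType} {D : nat}.
Local Notation C := R[i].
Local Notation factor := ('M[C]_D * ('I_D * 'I_D))%type.
Implicit Types (x : factor) (s : seq factor) (V X A B F G : 'M[C]_D).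

Lemma comm_entry_sum (I : finType) (a : I -> C) (X : I -> 'M[C]_D) V x :
  comm_entry (\sum_k a k *: X k) V x = \sum_k a k * comm_entry (X k) V x.
Proof.
rewrite /comm_entry mulmx_suml mulmx_sumr -sumrB summxE; apply: eq_bigr => k _.
by rewrite -scalemxAl -scalemxAr -scalerBr mxE.
Qed.

Lemma comm_entry_1B X V x : comm_entry (1%:M - X) V x = - comm_entry X V x.
Proof. by rewrite /comm_entry mulmxBl mulmxBr mul1mx mulmx1 !mxE; ring. Qed.

Lemma comm_entry_delta (p q : 'I_D) V x :
  comm_entry (delta_mx p q) V x =
  (x.2.1 == p)%:R * twirl V x.1 q x.2.2 - (x.2.2 == q)%:R * twirl V x.1 x.2.1 p.
Proof.
rewrite /comm_entry mxE [X in _ + X]mxE; congr (_ - _).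
  rewrite mxE (bigD1 q) //= big1 ?addr0; last first.
    by move=> k /negPf nk; rewrite [delta_mx _ _ _ _]mxE nk andbF mul0r.
  by rewrite [delta_mx _ _ _ _]mxE eqxx andbT.
rewrite mxE (bigD1 p) //= big1 ?addr0; last first.
  by move=> k /negPf nk; rewrite [delta_mx _ _ _ _]mxE nk mulr0.
by rewrite [delta_mx _ _ _ _]mxE eqxx /= mulrC.
Qed.

(* The rank one matrix w w^* for w = e_p + om e_q. *)
Definition rank1_pq (p q : 'I_D) (om : C) : 'M[C]_D :=
  delta_mx p p + delta_mx q q + om^* *: delta_mx p q + om *: delta_mx q p.

(** The matrix factors as [w *m v] with [v] adjoint to [w], and [v *m w] is [1 + |om|^2 = 2]. *)
Lemma rank1_pq_sqr p q om : p != q -> om * om^* = 1 ->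
  rank1_pq p q om *m rank1_pq p q om = 2 *: rank1_pq p q om.
Proof.
move=> pq u; have qp : (q == p) = false by rewrite eq_sym (negPf pq).
pose w : 'cV[C]_D := delta_mx p 0 + om *: delta_mx q 0.
pose v : 'rV[C]_D := delta_mx 0 p + om^* *: delta_mx 0 q.
have wv : w *m v = rank1_pq p q om.
  rewrite mulmxDl !mulmxDr -!scalemxAl -!scalemxAr !mul_delta_mx scalerA u scale1r.
  by rewrite /rank1_pq [_ *: _ + delta_mx q q]addrC addrACA addrA.
have vw : v *m w = 2%:M.
  rewrite mulmxDl !mulmxDr -!scalemxAl -!scalemxAr !mul_delta_mx_cond !eqxx.
  rewrite qp (negPf pq) !mulr0n !mulr1n !scaler0 addr0 add0r scalerA [_ * om]mulrC u.
  by rewrite scale1r [RHS]mx11_scalar; apply/matrixP => i j; rewrite !ord1 !mxE.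
by rewrite -wv mulmxA -(mulmxA w) vw mul_mx_scalar -scalemxAl.
Qed.

Lemma rank1_pq_herm p q om : (rank1_pq p q om)^t* = rank1_pq p q om.
Proof.
apply/matrixP => i j; rewrite !mxE !rmorphD !rmorphM /= conjCK !conjC_nat.
rewrite ![(j == _) && _]andbC; ring.
Qed.

Section Haar.
Context {dT : measure_display} {T : measurableType dT} {P : probability T R}.
Context {U : T -> 'M[C]_D}.
Hypothesis haarU : haar_ensemble P U.
Let ensU : unitary_ensemble P U := proj1 haarU.

Lemma bmeasC_ward X s : bmeasC (fun w => leibniz (entry (U w)) (comm_entry X (U w)) s).
Proof.
by apply: bmeasC_leibniz => x;
  [exact: (bmeasC_twirl ensU) | exact: (bmeasC_comm_entry ensU)].
Qed.

(** Since [M *m M = 2 M], the matrix [1 - M] is a Hermitian involution, and its commutators are the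
    opposites of those of [M]. *)
Lemma ward_rank1 p q om s : p != q -> om * om^* = 1 ->
  Ec P (fun w => leibniz (entry (U w)) (comm_entry (rank1_pq p q om) (U w)) s) = 0.
Proof.
move=> pq u; set M := rank1_pq p q om.
have W : Ec P (fun w => leibniz (entry (U w)) (comm_entry (1%:M - M) (U w)) s) = 0.
  apply: (ward_involution haarU).
    rewrite mulmxBl !mulmxBr !mulmx1 !mul1mx rank1_pq_sqr // -/M.
    by generalize M => ?; apply/matrixP => i j; rewrite !mxE; ring.
  by rewrite linearB /= map_mxB rank1_pq_herm trmx1 map_mx1.
apply/eqP; rewrite -oppr_eq0 -EcN; last exact: bmeasC_ward.
apply/eqP; rewrite -[RHS]W; congr Ec; apply: funext => w.
rewrite -mulN1r -leibnizZ; apply: eq_leibniz => x.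
by rewrite comm_entry_1B mulN1r.
Qed.

(* Schwinger-Dyson equation of the Haar measure along E_pq; polarisation
   recovers E_pq from the rank one matrices. *)
Lemma ward p q s : p != q ->
  Ec P (fun w => leibniz (entry (U w)) (comm_entry (delta_mx p q) (U w)) s) = 0.
Proof.
move=> pq.
(* With [om = i^k], the weight of [E_pq] is [i^k] times its conjugate, that is 1. The weights of the
   other three matrices, [i^k] or [i^(2k)], sum to 0 over [k < 4]. *)
have -> : delta_mx p q =
    \sum_(k < 4) (4^-1 * 'i ^+ k) *: rank1_pq p q ('i ^+ k) :> 'M[C]_D.
  rewrite !big_ord_recl big_ord0 /= /bump /rank1_pq /= !rmorphXn /= conjCi.
  move: (delta_mx p p) (delta_mx p q) (delta_mx q p) (delta_mx q q) => M1 M2 M3 M4.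
  apply/matrixP => i j; rewrite !mxE.
  have i2 : 'i ^+ 2 = -1 :> C by exact: sqrCi.
  by field: i2.
have -> : (fun w => leibniz (entry (U w)) (comm_entry (\sum_(k < 4)
      (4^-1 * 'i ^+ k) *: rank1_pq p q ('i ^+ k)) (U w)) s) =
    (fun w => \sum_(k < 4) (4^-1 * 'i ^+ k) *
      leibniz (entry (U w)) (comm_entry (rank1_pq p q ('i ^+ k)) (U w)) s).
  apply: funext => w; under [RHS]eq_bigr do rewrite -leibnizZ.
  by rewrite leibniz_sum; apply: eq_leibniz => x; rewrite comm_entry_sum.
rewrite Ec_sum; last by move=> k _; apply: bmeasCZ; exact: bmeasC_ward.
rewrite big1 // => k _; rewrite EcZ ?ward_rank1 ?mulr0 //; last exact: bmeasC_ward.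
by rewrite -normCK normrX normCi expr1n expr1n.
Qed.

Definition row_moment (b : 'I_D) (L : seq 'M[C]_D) : C :=
  Ec P (fun w => \prod_(B <- L) twirl (U w) B b b).

(* Sum over m <> b of the Ward identities along E_mb for A_mb * prod_B B_bb. *)
Lemma row_recursion b A (L : seq 'M[C]_D) :
  (D + size L)%:R * row_moment b (A :: L) =
  \tr A * row_moment b L +
  Ec P (fun w => leibniz (fun B => twirl (U w) B b b)
                         (fun B => twirl (U w) (B *m A) b b) L).
Proof.
have bP L' : bmeasC (fun w => \prod_(B <- L') twirl (U w) B b b).
  by apply: bmeasC_prod => B; exact: (bmeasC_twirl ensU).
have bL : bmeasC (fun w => leibniz (fun B => twirl (U w) B b b)
                         (fun B => twirl (U w) (B *m A) b b) L).
  by apply: bmeasC_leibniz => B; exact: (bmeasC_twirl ensU).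
(* Along [E_mb] the factor of [A] at [(m, b)] becomes [A_bb - A_mm], and each [B_bb] becomes
   [- B_bm]. *)
pose s (m : 'I_D) : seq factor := (A, (m, b)) :: [seq (B, (b, b)) | B <- L].
have : Ec P (fun w => \sum_(m | m != b)
    leibniz (entry (U w)) (comm_entry (delta_mx m b) (U w)) (s m)) = 0.
  rewrite Ec_sum; last by move=> m _; exact: bmeasC_ward.
  by rewrite big1 // => m mb; exact: ward.
have -> : (fun w => \sum_(m | m != b)
      leibniz (entry (U w)) (comm_entry (delta_mx m b) (U w)) (s m)) =
    (fun w => (D + size L)%:R * \prod_(B <- A :: L) twirl (U w) B b b -
      (\tr A * \prod_(B <- L) twirl (U w) B b b +
       leibniz (fun B => twirl (U w) B b b)
               (fun B => twirl (U w) (B *m A) b b) L)).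
  apply: funext => w; have uU := proj1 ensU w.
  rewrite /s /=.
  under eq_bigr => m mb.
    rewrite comm_entry_delta /= !eqxx !mul1r big_map leibniz_map.
    rewrite (_ : leibniz _ _ _ = leibniz (fun B => twirl (U w) B b b)
       (fun B => - 1 * twirl (U w) B b m) L); last first.
      apply: eq_leibniz => B /=.
      by rewrite comm_entry_delta /= eq_sym (negPf mb) eqxx mul0r sub0r mul1r mulN1r.
    rewrite /entry /= -leibnizZ.
    over.
  rewrite big_split /= leibniz_sum -mulr_suml.
  have -> : \sum_(m | m != b) (twirl (U w) A b b - twirl (U w) A m m) =
      D%:R * twirl (U w) A b b - \tr A.
    rewrite -(mxtrace_twirl _ A uU) /mxtrace.
    rewrite -[RHS]/(_ - _) [in RHS](bigD1 b) //= sumrB sumr_const.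
    have -> : #|[pred m | m != b]| = D.-1.
      by rewrite -[in RHS](card_ord D) -(cardC1 b); apply: eq_card => m; rewrite !inE.
    have -> : (D%:R : C) = D.-1%:R + 1.
      by rewrite natr1 prednK // (leq_ltn_trans _ (ltn_ord b)).
    by rewrite -mulr_natl; ring.
  (* The sum of [B_bm A_mb] over [m <> b] is the entry of [B *m A] less its term [m = b]. These
     missing terms add [size L] to the coefficient [D]. *)
  rewrite (eq_leibniz _ _ (fun B => twirl (U w) A b b * twirl (U w) B b b
      + -1 * twirl (U w) (B *m A) b b)); last first.
    move=> B; rewrite -mulmx_twirl // [X in -1 * X]mxE [X in _ = _ + -1 * X](bigD1 b) //=.
    rewrite mulrDr mulN1r mulrC addrA subrr add0r mulr_sumr.
    by apply: eq_bigr => m _; ring.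
  by rewrite leibnizD !leibnizZ leibniz_id big_cons natrD; ring.
rewrite EcB ?EcD ?EcZ //; do ?[exact: bmeasCZ | apply: bmeasCD => //].
by move/eqP; rewrite subr_eq0 => /eqP.
Qed.

Lemma row_moment1 b A : D%:R * row_moment b [:: A] = \tr A.
Proof.
have := row_recursion b A [::]; rewrite addn0 /= => ->.
rewrite /row_moment; under eq_fun do rewrite big_nil.
by rewrite !Ec_cst mulr1 addr0.
Qed.

Lemma row_moment2 b A B : (D + 1)%:R * row_moment b [:: A; B] =
  \tr A * row_moment b [:: B] + row_moment b [:: B *m A].
Proof.
have := row_recursion b A [:: B]; rewrite /= => ->; congr (_ + _).
by congr Ec; apply: funext => w; rewrite !big_cons big_nil mulr0 addr0.
Qed.

Lemma row_moment3 b A B F : (D + 2)%:R * row_moment b [:: A; B; F] =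
  \tr A * row_moment b [:: B; F] + row_moment b [:: B *m A; F]
  + row_moment b [:: B; F *m A].
Proof.
have bP L' : bmeasC (fun w => \prod_(B <- L') twirl (U w) B b b).
  by apply: bmeasC_prod => ?; exact: (bmeasC_twirl ensU).
have := row_recursion b A [:: B; F]; rewrite /= => ->; rewrite -addrA; congr (_ + _).
rewrite /row_moment -EcD //; congr Ec; apply: funext => w.
rewrite !big_cons big_nil.
generalize (twirl (U w) B b b) (twirl (U w) F b b).
by generalize (twirl (U w) (B *m A) b b) (twirl (U w) (F *m A) b b) => *; ring.
Qed.

Lemma row_moment4 b A B F G : (D + 3)%:R * row_moment b [:: A; B; F; G] =
  \tr A * row_moment b [:: B; F; G] + row_moment b [:: B *m A; F; G]
  + row_moment b [:: B; F *m A; G] + row_moment b [:: B; F; G *m A].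
Proof.
have bP L' : bmeasC (fun w => \prod_(B <- L') twirl (U w) B b b).
  by apply: bmeasC_prod => ?; exact: (bmeasC_twirl ensU).
have := row_recursion b A [:: B; F; G]; rewrite /= => ->.
rewrite -!addrA; congr (_ + _).
rewrite /row_moment -!EcD //; last exact: bmeasCD.
congr Ec; apply: funext => w; rewrite !big_cons big_nil.
generalize (twirl (U w) B b b) (twirl (U w) F b b) (twirl (U w) G b b).
generalize (twirl (U w) (B *m A) b b) (twirl (U w) (F *m A) b b).
by generalize (twirl (U w) (G *m A) b b) => *; ring.
Qed.

End Haar.
End Moments.

(** * Two-row moments and the Haar averages of the channel and of the squared estimator *)

Section SecondMoment.
Context {R : realType} {D : nat}.
Local Notation C := R[i].
Local Notation factor := ('M[C]_D * ('I_D * 'I_D))%type.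
Implicit Types (V X A B F G : 'M[C]_D).

Lemma sum_offdiag F G (b : 'I_D) :
  \sum_(c | c != b) \sum_(m | (m != b) && (m != c))
    ((F c c - F m m) * G c c - F m c * G c m) =
  D%:R * (\sum_c F c c * G c c) - (\tr F * \tr G + \tr (G *m F))
  + \tr F * G b b + \tr G * F b b + (G *m F) b b + (F *m G) b b
  - (D + 2)%:R * (F b b * G b b).
Proof.
pose h c m := (F c c - F m m) * G c c - F m c * G c m.
(* This is the sum over all [m], corrected for the excluded indices [m = b] and [m = c]. *)
pose f c := D%:R * (F c c * G c c) - \tr F * G c c - (G *m F) c c
  + F b b * G c c + F b c * G c b.
have inner c : c != b -> \sum_(m | (m != b) && (m != c)) h c m = f c.
  move=> cb.
  have : \sum_m h c m = D%:R * (F c c * G c c) - \tr F * G c c - (G *m F) c c.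
    rewrite /h sumrB; congr (_ - _).
      rewrite -mulr_suml sumrB sumr_const card_ord -mulr_natl /mxtrace; ring.
    by rewrite mxE; apply: eq_bigr => m _; rewrite mulrC.
  rewrite (bigD1 b) //= (bigD1 c) //= /f => <-; rewrite /h; ring.
rewrite (eq_bigr f) => [|c cb]; last exact: inner.
have -> : \sum_(c | c != b) f c = \sum_c f c - f b.
  by rewrite [in RHS](bigD1 b) //= addrAC subrr add0r.
have -> : \sum_c f c = D%:R * (\sum_c F c c * G c c) - \tr F * \tr G
    - \tr (G *m F) + F b b * \tr G + (F *m G) b b.
  by rewrite /f !big_split /= -!sumrN -?mulr_sumr !sumrN /mxtrace
     -!mulr_sumr [(F *m G) b b]mxE.
rewrite /f natrD; ring.
Qed.

Section Haar.
Context {dT : measure_display} {T : measurableType dT} {P : probability T R}.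
Context {U : T -> 'M[C]_D}.
Hypothesis haarU : haar_ensemble P U.
Let ensU : unitary_ensemble P U := proj1 haarU.
Local Notation rowm := (row_moment (P := P) (U := U)).

(** This is the Ward identity along [E_mc]; as [m] and [c] differ from [b], the derivation kills the
    factors at [(b, b)]. *)
Lemma offdiag_vanish b c m A B F G : c != b -> m != b -> m != c ->
  Ec P (fun w => twirl (U w) A b b * twirl (U w) B b b *
    ((twirl (U w) F c c - twirl (U w) F m m) * twirl (U w) G c c
     - twirl (U w) F m c * twirl (U w) G c m)) = 0.
Proof.
move=> cb mb mc.
have := ward haarU m c [:: (F, (m, c)); (G, (c, c)); (A, (b, b)); (B, (b, b))] mc.
move=> <-; congr Ec; apply: funext => w.
rewrite /= !comm_entry_delta /= !big_cons !big_nil /entry /=.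
rewrite !eqxx ![b == _]eq_sym ![c == m]eq_sym (negPf cb) (negPf mb) (negPf mc).
rewrite !(mulr0n, mulr1n).
generalize (twirl (U w) A b b) (twirl (U w) B b b) (twirl (U w) F c c).
generalize (twirl (U w) F m m) (twirl (U w) G c c) (twirl (U w) F m c).
generalize (twirl (U w) G c m) (twirl (U w) A c b) (twirl (U w) A b m).
by generalize (twirl (U w) B c b) (twirl (U w) B b m) => *; ring.
Qed.

(* Ward identities along E_mc for A_bb B_bb F_mc G_cc, summed over distinct
   m, c <> b. *)
Lemma row_pair_moment b A B F G :
  D%:R * Ec P (fun w => twirl (U w) A b b * twirl (U w) B b b *
                 \sum_c twirl (U w) F c c * twirl (U w) G c c) =
  (\tr F * \tr G + \tr (G *m F)) * rowm b [:: A; B]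
  - \tr F * rowm b [:: A; B; G] - \tr G * rowm b [:: A; B; F]
  + (D + 2)%:R * rowm b [:: A; B; F; G]
  - rowm b [:: A; B; G *m F] - rowm b [:: A; B; F *m G].
Proof.
have bP L' : bmeasC (fun w => \prod_(B <- L') twirl (U w) B b b).
  by apply: bmeasC_prod => ?; exact: (bmeasC_twirl ensU).
have bt X i j : bmeasC (fun w => twirl (U w) X i j) by exact: (bmeasC_twirl ensU).
pose tail w := \sum_c twirl (U w) F c c * twirl (U w) G c c.
pose h c m w := (twirl (U w) F c c - twirl (U w) F m m) * twirl (U w) G c c
     - twirl (U w) F m c * twirl (U w) G c m.
have bt2 X i j Y k l : bmeasC (fun w => twirl (U w) X i j * twirl (U w) Y k l).
  exact: bmeasCM.
have bh c m : bmeasC (h c m).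
  by apply: bmeasCB => //; apply: bmeasCM => //; exact: bmeasCB.
have btail : bmeasC tail by exact: bmeasC_sum.
have : Ec P (fun w => \sum_(c | c != b) \sum_(m | (m != b) && (m != c))
    twirl (U w) A b b * twirl (U w) B b b * h c m w) = 0.
  rewrite Ec_sum; last by move=> c _; apply: bmeasC_sum => m _; exact: bmeasCM.
  rewrite big1 // => c cb; rewrite Ec_sum; last by move=> m _; exact: bmeasCM.
  by rewrite big1 // => m /andP[mb mc]; exact: offdiag_vanish.
have -> : (fun w => \sum_(c | c != b) \sum_(m | (m != b) && (m != c))
    twirl (U w) A b b * twirl (U w) B b b * h c m w) = (fun w =>
   D%:R * (twirl (U w) A b b * twirl (U w) B b b * tail w)
   - ((\tr F * \tr G + \tr (G *m F)) * \prod_(X <- [:: A; B]) twirl (U w) X b b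
     + (- \tr F * \prod_(X <- [:: A; B; G]) twirl (U w) X b b
     + (- \tr G * \prod_(X <- [:: A; B; F]) twirl (U w) X b b
     + ((D + 2)%:R * \prod_(X <- [:: A; B; F; G]) twirl (U w) X b b
     + (- 1 * \prod_(X <- [:: A; B; G *m F]) twirl (U w) X b b
     + - 1 * \prod_(X <- [:: A; B; F *m G]) twirl (U w) X b b)))))).
  apply: funext => w; have uU := proj1 ensU w.
  transitivity (twirl (U w) A b b * twirl (U w) B b b *
      \sum_(c | c != b) \sum_(m | (m != b) && (m != c)) h c m w).
    by rewrite mulr_sumr; apply: eq_bigr => c _; rewrite mulr_sumr.
  rewrite /h sum_offdiag !mulmx_twirl // !mxtrace_twirl //.
  rewrite !big_cons !big_nil /tail.
  move: (twirl (U w) (G *m F) b b) (twirl (U w) (F *m G) b b) (\tr (G *m F)).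
  move: (\tr F) (\tr G) (\sum_c twirl (U w) F c c * twirl (U w) G c c).
  move: (twirl (U w) A b b) (twirl (U w) B b b) (twirl (U w) F b b) (twirl (U w) G b b).
  by move=> *; ring.
have bZ a L : bmeasC (fun w => a * \prod_(X <- L) twirl (U w) X b b).
  exact: bmeasCZ.
rewrite EcB; last 2 first.
- by apply: bmeasCZ; apply: bmeasCM.
- by do ?apply: bmeasCD => //.
rewrite EcZ; last exact: bmeasCM.
move/eqP; rewrite subr_eq0 => /eqP ->.
rewrite EcD //; last by do ?apply: bmeasCD => //.
rewrite EcD //; last by do ?apply: bmeasCD => //.
rewrite EcD //; last by do ?apply: bmeasCD => //.
rewrite EcD //; last by do ?apply: bmeasCD => //.
rewrite EcD // !EcZ // /row_moment; ring.
Qed.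

Hypothesis D_gt0 : (0 < D)%N.
Let d_neq0 : D%:R != 0 :> C. Proof. by rewrite pnatr_eq0 -lt0n. Qed.
Let dS_neq0 k : D%:R + k.+1%:R != 0 :> C.
Proof. by rewrite -natrD pnatr_eq0 addnS. Qed.

Lemma row_moment2E b A B : rowm b [:: A; B] =
  (\tr A * \tr B + \tr (B *m A)) / (D%:R * (D%:R + 1)).
Proof.
have := row_moment2 haarU b A B; have := row_moment1 haarU b B.
have := row_moment1 haarU b (B *m A); rewrite natrD => h1 h2 h3.
apply: (mulfI (dS_neq0 0)); rewrite h3 -h1 -h2; field.
by rewrite d_neq0 (dS_neq0 0).
Qed.

(** The numerator runs over the six permutations of three letters, with one trace per cycle; the
    denominator is 6 times the dimension of the symmetric cube. *)
Lemma row_moment3E b A B F : rowm b [:: A; B; F] =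
  (\tr A * \tr B * \tr F + \tr A * \tr (F *m B) + \tr (B *m A) * \tr F
   + \tr (F *m B *m A) + \tr B * \tr (F *m A) + \tr (F *m A *m B))
  / (D%:R * (D%:R + 1) * (D%:R + 2)).
Proof.
have := row_moment3 haarU b A B F; rewrite !row_moment2E natrD mulmxA => h.
apply: (mulfI (dS_neq0 1)); rewrite h; field.
by rewrite d_neq0 (dS_neq0 0) (dS_neq0 1).
Qed.

Lemma haar_second_moment (rho O : 'M[C]_D) (d : C := D%:R) :
  \tr rho = 1 -> \tr O = 0 ->
  Ec P (fun w => (\sum_b twirl (U w) rho b b * twirl (U w) O b b) ^+ 2) =
  (\tr (rho *m O)) ^+ 2 / (d * (d + 1)) +
  (((d + 2) * \tr (rho *m rho) - 1) * \tr (O *m O)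
   - 2 * (\tr (rho *m O)) ^+ 2 - 4 * \tr (rho *m O *m O)
   + (2 * d + 2) * \tr (rho *m rho *m O *m O)
   - 2 * \tr (rho *m O *m rho *m O)) / (d * (d + 1) * (d + 2) * (d + 3)).
Proof.
move=> tr1 tr0.
set r := \tr (rho *m O); set l := \tr (rho *m rho); set q := \tr (O *m O).
set s := \tr (rho *m O *m O); set z := \tr (rho *m rho *m O *m O).
set k := \tr (rho *m O *m rho *m O).
have cyc A B : \tr (A *m B) = \tr (B *m A) by exact: mxtrace_mulC.
have rE : \tr (O *m rho) = r by exact: cyc.
have s1 : \tr (O *m rho *m O) = s by rewrite cyc mulmxA cyc mulmxA.
have s2 : \tr (O *m O *m rho) = s by rewrite cyc mulmxA.
have k1 : \tr (O *m rho *m O *m rho) = k by rewrite cyc !mulmxA.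
have z1 : \tr (O *m O *m rho *m rho) = z by rewrite cyc mulmxA cyc !mulmxA.
have z2 : \tr (O *m rho *m rho *m O) = z.
  by rewrite -z1 cyc !mulmxA.
have z3 : \tr (rho *m O *m O *m rho) = z by rewrite cyc !mulmxA.
(* The value does not depend on the row [b], so summing over the [D] rows cancels the factor
   [D%:R^-1]. *)
have row_term b : Ec P (fun w => twirl (U w) rho b b * twirl (U w) O b b *
    \sum_c twirl (U w) rho c c * twirl (U w) O c c) =
  D%:R^-1 * (r ^+ 2 / (d * (d + 1)) +
  (((d + 2) * l - 1) * q - 2 * r ^+ 2 - 4 * s
   + (2 * d + 2) * z - 2 * k) / (d * (d + 1) * (d + 2) * (d + 3))).
  apply: (mulfI d_neq0); rewrite row_pair_moment mulrA divff // mul1r.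
  have := row_moment4 haarU b rho O rho O.
  rewrite natrD -/d => /(canRL (mulKf (dS_neq0 2))) ->.
  rewrite !row_moment3E !row_moment2E -/d !natrD -/d !mulmxA tr1 tr0.
  rewrite ?(rE, s1, s2, k1, z1, z2, z3) -/r -/l -/q -/s -/z -/k.
  move: d_neq0 (dS_neq0 0) (dS_neq0 1) (dS_neq0 2); rewrite -/d.
  generalize d r l q s z k => d' ? ? ? ? ? ? n0 n1 n2 n3.
  by field; rewrite n0 n1 n2 n3.
have bt X i j : bmeasC (fun w => twirl (U w) X i j) by exact: (bmeasC_twirl ensU).
under eq_fun do rewrite expr2 mulr_suml.
rewrite Ec_sum; last first.
  move=> b _; apply: bmeasCM; first exact: bmeasCM.
  by apply: bmeasC_sum => c _; exact: bmeasCM.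
rewrite (eq_bigr _ (fun b _ => row_term b)) sumr_const card_ord -[LHS]mulr_natl.
by rewrite mulVKf.
Qed.

(** Conjugating [E_ji] and reading the entry [(b, b)] gives the entry [(i, j)] of the projection
    onto the measured state [b] rotated back by [U], so the left side is an entry of the channel. *)
Lemma haar_channel_entry (X : 'M[C]_D) (i j : 'I_D) (d : C := D%:R) :
  \sum_b Ec P (fun w => twirl (U w) X b b * twirl (U w) (delta_mx j i) b b) =
  (X i j + \tr X * (i == j)%:R) / (d + 1).
Proof.
have term b : Ec P (fun w => twirl (U w) X b b * twirl (U w) (delta_mx j i) b b) =
    (\tr X * (i == j)%:R + X i j) / (d * (d + 1)).
  have := row_moment2E b X (delta_mx j i); rewrite /row_moment.
  under eq_fun do rewrite !big_cons big_nil mulr1.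
  move=> ->; congr ((_ * _ + _) / _).
    rewrite /mxtrace; under eq_bigr do rewrite mxE.
    rewrite (bigD1 i) //= eqxx andbT big1 ?addr0 // => k /negPf nk.
    by rewrite nk andbF.
  rewrite /mxtrace (bigD1 j) //= big1 ?addr0.
    rewrite mxE (bigD1 i) //= big1 ?addr0 ?mxE ?eqxx ?mul1r // => k /negPf nk.
    by rewrite mxE nk andbF mul0r.
  move=> k /negPf nk; rewrite mxE big1 // => m _.
  by rewrite mxE nk mul0r.
rewrite (eq_bigr _ (fun b _ => term b)) sumr_const card_ord -[LHS]mulr_natl -/d.
by field; rewrite d_neq0 (dS_neq0 0).
Qed.

End Haar.
End SecondMoment.

Lemma mul_delta_entry (K : pzRingType) (m n o r : nat) (A : 'M[K]_(m, n))
    (B : 'M[K]_(o, r)) p q i j :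
  (A *m delta_mx p q *m B) i j = A i p * B q j.
Proof.
rewrite mxE (bigD1 q) //= big1 ?addr0; last first.
  move=> k /negPf nk; rewrite mxE big1 ?mul0r // => l _.
  by rewrite mxE nk andbF mulr0.
rewrite mxE (bigD1 p) //= big1 ?addr0; last first.
  by move=> k /negPf nk; rewrite mxE nk mulr0.
by rewrite mxE !eqxx mulr1.
Qed.

(** * Transfer to 4-designs *)

Section Design.
Context {R : realType} {D : nat}.
Local Notation C := R[i].
Local Notation factor := ('M[C]_D * ('I_D * 'I_D))%type.
Context {dT : measure_display} {T : measurableType dT} {P : probability T R}.
Context {U : T -> 'M[C]_D}.
Hypothesis designU : unitary_design 4 P U.
Let ensU : unitary_ensemble P U := proj1 designU.

Lemma design_haar : exists (dH : measure_display) (TH : measurableType dH)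
    (PH : probability TH R) (UH : TH -> 'M[C]_D),
  haar_ensemble PH UH /\ forall x1 x2 x3 x4 : factor,
    Ec P (fun w => entry (U w) x1 * entry (U w) x2 * (entry (U w) x3 * entry (U w) x4)) =
    Ec PH (fun w => entry (UH w) x1 * entry (UH w) x2 * (entry (UH w) x3 * entry (UH w) x4)).
Proof.
have [dH [TH [PH [UH [haarH eqH]]]]] := proj2 designU.
exists dH, TH, PH, UH; split=> // x1 x2 x3 x4.
pose x (a : 'I_4) := nth x1 [:: x1; x2; x3; x4] a.
have prodE (V : 'M[C]_D) :
    entry V x1 * entry V x2 * (entry V x3 * entry V x4) = \prod_(a < 4) entry V (x a).
  by rewrite !big_ord_recl big_ord0 /x /= mulr1 !mulrA.
under eq_fun do rewrite prodE.
under [in RHS]eq_fun do rewrite prodE.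
rewrite (Ec_prod_entry ensU) (Ec_prod_entry (proj1 haarH)).
by apply: eq_bigr => f _; rewrite eqH.
Qed.

Hypothesis D_gt0 : (0 < D)%N.
Let d : C := D%:R.

Lemma design_channel (X : 'M[C]_D) :
  meas_channel P U X = (d + 1)^-1 *: (X + (\tr X)%:M).
Proof.
have [dH [TH [PH [UH [haarH eqH]]]]] := design_haar.
apply/matrixP => i j; rewrite /meas_channel summxE !mxE.
have := haar_channel_entry haarH D_gt0 X i j; rewrite mulr_natr mulrC => <-.
apply: eq_bigr => b _; rewrite mxE.
(* The channel only has degree (2,2). Two factors built on the identity matrix, whose value is 1,
   raise it to (4,4). *)
pose x : factor := (1%:M, (b, b)).
have entry1 (V : 'M[C]_D) : V \is unitarymx -> entry V x = 1.
  by move=> uV; rewrite /entry /twirl mulmx1 unitarymx_mul // mxE eqxx.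
have := eqH (X, (b, b)) (delta_mx j i, (b, b)) x x.
have [dropU dropUH] : (forall w, entry (U w) x = 1) /\ (forall w, entry (UH w) x = 1).
  by split=> w; apply: entry1; [exact: (proj1 ensU) | exact: (proj1 (proj1 haarH))].
under eq_fun do rewrite dropU !mulr1.
under [in RHS]eq_fun do rewrite dropUH !mulr1.
rewrite /entry /= => <-; congr Ec; apply: funext => w; rewrite mxE; congr (_ * _).
by rewrite /twirl !mul_delta_entry !mxE mulrC.
Qed.

Lemma design_channel_inverse (Minv : 'M[C]_D -> 'M[C]_D) (O : 'M[C]_D) :
  channel_inverse P U Minv -> \tr O = 0 -> Minv O = (d + 1) *: O.
Proof.
move=> invM tr0; rewrite -[RHS](proj2 (invM _)) design_channel.
rewrite mxtraceZ tr0 mulr0 raddf0 addr0 scalerA mulVf ?scale1r //.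
by rewrite /d natr1 pnatr_eq0.
Qed.

(** The inverse channel scales [O] by [d + 1], hence the second moment by [(d + 1)^2]. The first
    summand arises as [(d + 1) / d * r^2 - r^2 = r^2 / d], with [r] the trace of [rho *m O]. *)
Lemma design_Vstar (Minv : 'M[C]_D -> 'M[C]_D) (rho O : 'M[C]_D) :
  channel_inverse P U Minv -> \tr rho = 1 -> \tr O = 0 ->
  Vstar_rho P U Minv O rho =
  ((\tr (rho *m O)) ^+ 2 + (d + 1) *
  (((d + 2) * \tr (rho *m rho) - 1) * \tr (O *m O)
   - 2 * (\tr (rho *m O)) ^+ 2 - 4 * \tr (rho *m O *m O)
   + (2 * d + 2) * \tr (rho *m rho *m O *m O)
   - 2 * \tr (rho *m O *m rho *m O)) / ((d + 2) * (d + 3))) / d.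
Proof.
move=> invM tr1 tr0; rewrite /Vstar_rho (design_channel_inverse _ _ invM tr0).
have [dH [TH [PH [UH [haarH eqH]]]]] := design_haar.
have := haar_second_moment haarH D_gt0 rho O tr1 tr0.
(* The square becomes a double sum over rows of products of four entries, on which design and Haar
   expectations agree. *)
have expand (dS : measure_display) (S : measurableType dS) (Q : probability S R)
    (V : S -> 'M[C]_D) : unitary_ensemble Q V ->
    Ec Q (fun w => (\sum_b twirl (V w) rho b b * twirl (V w) O b b) ^+ 2) =
    \sum_b \sum_c Ec Q (fun w => entry (V w) (rho, (b, b)) * entry (V w) (O, (b, b)) *
                      (entry (V w) (rho, (c, c)) * entry (V w) (O, (c, c)))).
  move=> ensV; under eq_fun do rewrite expr2 mulr_suml.
  have bt X i j : bmeasC (fun w => twirl (V w) X i j) by exact: (bmeasC_twirl ensV).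
  rewrite Ec_sum; last first.
    move=> b _; apply: bmeasCM; first exact: bmeasCM.
    by apply: bmeasC_sum => c _; exact: bmeasCM.
  apply: eq_bigr => b _; under eq_fun do rewrite mulr_sumr.
  rewrite Ec_sum // => c _; apply: bmeasCM; exact: bmeasCM.
rewrite (expand _ _ _ _ (proj1 haarH)).
under eq_bigr do under eq_bigr do rewrite -eqH.
rewrite -(expand _ _ _ _ ensU) => h.
have -> : (fun t => (\sum_(b < D) (U t *m rho *m (U t)^t*) b b *
    (U t *m ((d + 1) *: O) *m (U t)^t*) b b) ^+ 2) =
  (fun t => (d + 1) ^+ 2 *
     (\sum_b twirl (U t) rho b b * twirl (U t) O b b) ^+ 2).
  apply: funext => t; rewrite -exprMn mulr_sumr; congr (_ ^+ 2).
  apply: eq_bigr => b _.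
  by rewrite -scalemxAr -scalemxAl [X in _ * X = _]mxE mulrCA.
rewrite EcZ; last first.
  have bt X i j : bmeasC (fun w => twirl (U w) X i j) by exact: (bmeasC_twirl ensU).
  have bs : bmeasC (fun t => \sum_b twirl (U t) rho b b * twirl (U t) O b b).
    by apply: bmeasC_sum => b _; exact: bmeasCM.
  by under eq_fun do rewrite expr2; exact: bmeasCM.
rewrite h -/d [\tr (O *m rho)]mxtrace_mulC.
have nz k : d + k%:R != 0 by rewrite /d -natrD pnatr_eq0 addn_eq0 negb_and -lt0n D_gt0.
have d_neq0 := nz 0%N; rewrite addr0 in d_neq0.
by field; rewrite (nz 1%N) (nz 2%N) (nz 3%N) d_neq0.
Qed.

End Design.

(** * Spectral decomposition of density operators and trace inequalities *)

Section Density.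
Context {C : numClosedFieldType} {D : nat}.
Implicit Types (rho O : 'M[C]_D).

Lemma density_diag rho : density rho ->
  exists2 W : 'M[C]_D, W \is unitarymx & exists2 lam : 'I_D -> C,
    (forall i, 0 <= lam i) /\ \sum_i lam i = 1 &
    W *m rho *m W^t* = diag_mx (\row_i lam i).
Proof.
move=> [hermr [posr tr1]].
have /orthomx_spectralP rE : rho \is normalmx.
  by apply/normalmxP; rewrite hermr.
set W := spectralmx rho in rE; set sp := spectral_diag rho in rE.
have uW : W \is unitarymx by exact: spectral_unitarymx.
have /unitarymxP WW := uW.
exists W => //; exists (fun i => sp 0 i).
  have diagE : W *m rho *m W^t* = diag_mx sp.
    rewrite {1}rE invmx_unitary // !mulmxA WW mul1mx.
    by rewrite -mulmxA WW mulmx1.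
  split.
    move=> i; have /matrixP/(_ i i) := diagE; rewrite [diag_mx sp i i]mxE eqxx mulr1n => <-.
    (* Positivity is tested on the [i]-th eigenvector, the adjoint of row [i] of [W]. *)
    have := posr ((row i W)^t*); rewrite trmxCK.
    congr (0 <= _); rewrite -row_mul [(_ *m _ ^t*) 0 0]mxE mxE.
    by apply: eq_bigr => j _; rewrite !mxE.
  rewrite -tr1 -[RHS]mulr1.
  have -> : \tr rho = \tr (diag_mx sp).
    rewrite -diagE mxtrace_mulC mulmxA (mulmx1C WW).
    by rewrite mul1mx.
  by rewrite mulr1 /mxtrace; apply: eq_bigr => i _; rewrite mxE eqxx mulr1n.
rewrite {1}rE invmx_unitary // !mulmxA WW mul1mx.
rewrite -mulmxA WW mulmx1.
by congr diag_mx; apply/rowP => i; rewrite mxE.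
Qed.

End Density.

Section DensityTraces.
Context {R : realType} {D : nat}.
Local Notation C := R[i].
Implicit Types (rho O : 'M[C]_D).

(** In an eigenbasis of [rho] the traces become sums weighted by eigenvalues in [[0, 1]], with [H]
    the matrix of [O] and [n i] the squared norm of its row [i]. Only the third bound needs more,
    namely a variance inequality. *)
Lemma density_trace_bounds rho O : density rho -> is_hermitian O ->
  [/\ \tr (rho *m rho) <= 1, 0 <= \tr (rho *m O *m rho *m O),
      (\tr (rho *m O)) ^+ 2 <= \tr (rho *m O *m O),
      0 <= \tr (rho *m O *m O) <= \tr (O *m O) &
      \tr (rho *m rho *m O *m O) <= \tr (rho *m O *m O)].
Proof.
move=> /density_diag[W uW [lam [lam0 lam1] rhoE]] hermO.
have lam_le1 i : lam i <= 1.
  by rewrite -lam1 (bigD1 i) //= lerDl sumr_ge0.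
pose H := twirl W O.
have hermH i j : (H i j)^* = H j i.
  have <- : H^t* j i = H j i.
    by rewrite /H /twirl !trmxC_mul trmxCK hermO mulmxA.
  by rewrite !mxE.
have trE A : \tr A = \tr (twirl W A) by rewrite mxtrace_twirl.
have rhoW : twirl W rho = diag_mx (\row_i lam i) := rhoE.
have diagE A i j : (diag_mx (\row_i lam i) *m A) i j = lam i * A i j.
  by rewrite mul_diag_mx !mxE.
pose n i := \sum_j `|H i j| ^+ 2.
have nE i : (H *m H) i i = n i.
  by rewrite mxE; apply: eq_bigr => j _; rewrite normCK hermH.
have n_ge0 i : 0 <= n i by apply: sumr_ge0 => j _; rewrite exprn_ge0.
have rE : \tr (rho *m O) = \sum_i lam i * H i i.
  by rewrite trE -mulmx_twirl // rhoW; apply: eq_bigr => i _; rewrite diagE.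
have sE : \tr (rho *m O *m O) = \sum_i lam i * n i.
  rewrite -mulmxA trE -!mulmx_twirl // rhoW; apply: eq_bigr => i _.
  by rewrite diagE nE.
have zE : \tr (rho *m rho *m O *m O) = \sum_i lam i * (lam i * n i).
  rewrite -!mulmxA trE -!mulmx_twirl // rhoW; apply: eq_bigr => i _.
  by rewrite !diagE nE.
have qE : \tr (O *m O) = \sum_i n i.
  by rewrite trE -mulmx_twirl //; apply: eq_bigr => i _; rewrite nE.
have lE : \tr (rho *m rho) = \sum_i lam i * lam i.
  rewrite trE -mulmx_twirl // rhoW; apply: eq_bigr => i _.
  by rewrite diagE !mxE eqxx mulr1n.
have kE : \tr (rho *m O *m rho *m O) =
    \sum_i lam i * \sum_j lam j * `|H i j| ^+ 2.
  rewrite -!mulmxA trE -!mulmx_twirl // rhoW; apply: eq_bigr => i _.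
  rewrite diagE mxE; congr (_ * _); apply: eq_bigr => j _.
  by rewrite diagE normCK hermH mulrCA.
split.
- by rewrite lE -lam1; apply: ler_sum => i _; rewrite ler_piMl.
- rewrite kE; apply: sumr_ge0 => i _; apply: mulr_ge0 => //.
  by apply: sumr_ge0 => j _; rewrite mulr_ge0 // exprn_ge0.
- rewrite rE sE; set r := \sum_i _.
  have rconj : r^* = r.
    rewrite /r rmorph_sum; apply: eq_bigr => i _.
    by rewrite rmorphM /= hermH conj_Creal // ger0_real.
  (* The variance of the [H i i] under the weights [lam] is nonnegative, so [r^2] is at most the
     weighted sum of the [H i i ^+ 2]. *)
  have sq_ge0 : 0 <= \sum_i lam i * (H i i - r) ^+ 2.
    apply: sumr_ge0 => i _; apply: mulr_ge0 => //.
    have -> : (H i i - r) ^+ 2 = `|H i i - r| ^+ 2.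
      by rewrite normCK rmorphB /= hermH rconj.
    by rewrite exprn_ge0.
  have le_diag : \sum_i lam i * H i i ^+ 2 <= \sum_i lam i * n i.
    apply: ler_sum => i _; apply: ler_wpM2l => //.
    rewrite /n (bigD1 i) //= normCK hermH lerDl; apply: sumr_ge0 => j _.
    by rewrite exprn_ge0.
  apply: le_trans le_diag; rewrite -subr_ge0; congr (0 <= _): sq_ge0.
  transitivity (\sum_i (lam i * H i i ^+ 2 + (- 2 * r) * (lam i * H i i) + r ^+ 2 * lam i)).
    by apply: eq_bigr => i _; ring.
  by rewrite !big_split /= -!mulr_sumr lam1 -/r; ring.
- rewrite sE qE sumr_ge0 => [|i _]; last exact: mulr_ge0.
  by apply: ler_sum => i _; rewrite ler_piMl.
- rewrite sE zE; apply: ler_sum => i _; apply: ler_wpM2l => //.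
  by rewrite ler_piMl.
Qed.

End DensityTraces.

(** * Rank one projections onto unit vectors *)

Section PureState.
Context {C : numClosedFieldType} {D : nat}.
Implicit Types phi : 'cV[C]_D.

Lemma pure_idem phi : unit_vector phi ->
  phi *m adj phi *m (phi *m adj phi) = phi *m adj phi.
Proof.
move=> uphi; rewrite /adj mulmxA -(mulmxA phi) [_^t* *m phi]mx11_scalar uphi.
by rewrite mulmx1.
Qed.

Lemma pure_trace phi : unit_vector phi -> \tr (phi *m adj phi) = 1.
Proof.
move=> uphi; rewrite /adj mxtrace_mulC [_^t* *m phi]mx11_scalar uphi.
by rewrite mxtrace_scalar mulr1n.
Qed.

Lemma pure_density phi : unit_vector phi -> density (phi *m adj phi).
Proof.
move=> uphi; have hermP : is_hermitian (phi *m adj phi).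
  by rewrite /is_hermitian /adj trmx_mul map_mxM trmxCK.
split=> //; split.
  move=> v; rewrite /adj mulmxA -mulmxA mxE big_ord1.
  have -> : (phi^t* *m v) 0 0 = ((v^t* *m phi) 0 0)^*.
    rewrite !mxE rmorph_sum; apply: eq_bigr => j _.
    by rewrite !mxE rmorphM /= conjCK mulrC.
  exact: mul_conjC_ge0.
exact: pure_trace.
Qed.

End PureState.

(** * The variance *)

Section Variance.
Context {R : realType} {D : nat}.
Local Notation C := R[i].
Context {dT : measure_display} {T : measurableType dT} {P : probability T R}.
Context {U : T -> 'M[C]_D} {Minv : 'M[C]_D -> 'M[C]_D}.
Hypothesis designU : unitary_design 4 P U.
Hypothesis invM : channel_inverse P U Minv.
Hypothesis D_gt1 : (1 < D)%N.
Let d : C := D%:R.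
Let D_gt0 : (0 < D)%N. Proof. exact: ltnW. Qed.
Let d_gt0 : 0 < d. Proof. by rewrite ltr0n. Qed.
Let dk_gt0 k : 0 < d + k%:R. Proof. by rewrite -natrD ltr0n addn_gt0 D_gt0. Qed.
Let d2_ge0 : 0 <= d - 2. Proof. by rewrite subr_ge0 ler_nat. Qed.

Lemma Vstar_le (O rho : 'M[C]_D) : is_hermitian O -> \tr O = 0 -> density rho ->
  Vstar_rho P U Minv O rho <= 4 / d * \tr (O *m O).
Proof.
move=> hermO tr0 denr; have tr1 := proj2 (proj2 denr).
have [l1 k0 rs /andP[_ sq] zs] := density_trace_bounds _ _ denr hermO.
rewrite (design_Vstar designU D_gt0 _ _ _ invM tr1 tr0) -/d.
have q0 : 0 <= \tr (O *m O).
  rewrite /mxtrace; apply: sumr_ge0 => i _; rewrite mxE; apply: sumr_ge0 => j _.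
  have /matrixP/(_ j i) := hermO; rewrite !mxE => <-.
  exact: mul_conjC_ge0.
move: l1 k0 rs sq zs q0.
set l := \tr (rho *m rho); set k := \tr (rho *m O *m rho *m O).
set r := \tr (rho *m O); set s := \tr (rho *m O *m O); set q := \tr (O *m O).
set z := \tr (rho *m rho *m O *m O).
rewrite -subr_ge0 => l1 k0; rewrite -subr_ge0 => rs; rewrite -subr_ge0 => sq.
rewrite -subr_ge0 => zs q0.
clearbody l k r s q z; rewrite -subr_ge0.
(* The gap is a combination of [q], [s - r^2], [q - s], [1 - l], [s - z] and [k], all nonnegative.
   Expanding in [d - 2], or in positive shifts of [d], makes the coefficients visibly nonnegative
   for [d >= 2]. *)
have -> : 4 / d * q - (r ^+ 2 + (d + 1) * (((d + 2) * l - 1) * q - 2 * r ^+ 2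
    - 4 * s + (2 * d + 2) * z - 2 * k) / ((d + 2) * (d + 3))) / d =
  ((15 * (d - 2) + 51) * q
   + ((d - 2) ^+ 2 + 7 * (d - 2) + 14) * ((s - r ^+ 2) + (q - s))
   + (d + 1) * (2 * (d - 2) + 2) * (q - s)
   + (d + 1) * ((d + 2) * (1 - l) * q + (2 * (d - 2) + 6) * (s - z) + 2 * k))
  / ((d + 2) * (d + 3) * d).
  by field; rewrite !gt_eqF ?dk_gt0.
have d1 := ltW (dk_gt0 1); have d2 := ltW (dk_gt0 2); have d3 := ltW (dk_gt0 3).
have d0 := ltW d_gt0.
by apply: divr_ge0; do ![assumption | exact: ler0n | exact: exprn_ge0
  | apply: mulr_ge0 | apply: addr_ge0].
Qed.

(** Since [Phi] is idempotent and [Phi *m rho *m Phi = f *: Phi], all traces reduce to [l], [f] and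
    [g]. The right side is arranged so that each subtracted term vanishes at [l = f = g = 1] and is
    nonnegative for density operators. *)
Lemma pure_Vstar (phi : 'cV[C]_D) (rho : 'M[C]_D) :
  unit_vector phi -> \tr rho = 1 ->
  let Phi := phi *m adj phi in
  let f := \tr (rho *m Phi) in
  let g := \tr (rho *m rho *m Phi) in
  let l := \tr (rho *m rho) in
  (d + 2) * (d + 3) * d * Vstar_rho P U Minv (Phi - d^-1%:M) rho =
  4 * d * (d - 1) - (d + 1) ^+ 2 * (1 - l) - (d + 1) * (2 * d - 2) * (f - g)
  - (1 - f) * ((d - 2) * (3 * d + 1) + (d ^+ 2 + d + 2) * f).
Proof.
move=> uphi tr1 Phi f g l.
have PhiPhi : Phi *m Phi = Phi := pure_idem _ uphi.
have trPhi : \tr Phi = 1 := pure_trace _ uphi.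
have fE : adj phi *m (rho *m phi) = f%:M.
  rewrite [LHS]mx11_scalar /f /Phi mulmxA mxtrace_mulC.
  by rewrite /mxtrace big_ord1.
have PrP : Phi *m rho *m Phi = f *: Phi.
  rewrite /Phi -!mulmxA (mulmxA rho) (mulmxA (adj phi)) fE mul_scalar_mx.
  by rewrite -scalemxAr.
clearbody Phi; set a := d^-1; set O := Phi - a%:M.
have tr0 : \tr O = 0.
  by rewrite /O linearB /= trPhi mxtrace_scalar -mulr_natl mulfV ?subrr // gt_eqF.
have rhoO : rho *m O = rho *m Phi - a *: rho by rewrite mulmxBr mul_mx_scalar.
have OO : O *m O = (1 - 2 * a) *: Phi + (a ^+ 2)%:M.
  rewrite /O mulmxBl !mulmxBr PhiPhi mul_mx_scalar !mul_scalar_mx.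
  by apply/matrixP => i j; rewrite !mxE; ring.
rewrite (design_Vstar designU D_gt0 _ _ _ invM tr1 tr0) -/d.
have -> : \tr (rho *m O *m rho *m O) = f ^+ 2 - 2 * a * g + a ^+ 2 * l.
  rewrite -mulmxA rhoO mulmxBl !mulmxBr.
  have -> : rho *m Phi *m (rho *m Phi) = f *: (rho *m Phi).
    by rewrite -mulmxA (mulmxA Phi) PrP -scalemxAr.
  rewrite -!scalemxAl -!scalemxAr !linearB /= !mxtraceZ !mulmxA -/f -/l -/g.
  rewrite [\tr (rho *m Phi *m rho)]mxtrace_mulC mulmxA -/g; ring.
have -> : \tr (rho *m rho *m O *m O) = (1 - 2 * a) * g + a ^+ 2 * l.
  by rewrite -mulmxA OO mulmxDr -scalemxAr mul_mx_scalar mxtraceD !mxtraceZ.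
have -> : \tr (rho *m O *m O) = (1 - 2 * a) * f + a ^+ 2.
  by rewrite -mulmxA OO mulmxDr -scalemxAr mul_mx_scalar mxtraceD !mxtraceZ tr1 mulr1.
have -> : \tr (O *m O) = (1 - 2 * a) + a ^+ 2 * d.
  by rewrite OO mxtraceD mxtraceZ trPhi mulr1 mxtrace_scalar mulr_natr.
have -> : \tr (rho *m O) = f - a.
  by rewrite rhoO linearB /= mxtraceZ tr1 mulr1.
rewrite -/l /a; field.
by rewrite !gt_eqF ?dk_gt0.
Qed.

Lemma pure_Vstar_self (phi : 'cV[C]_D) : unit_vector phi ->
  Vstar_rho P U Minv (phi *m adj phi - d^-1%:M) (phi *m adj phi) =
  4 * (d - 1) / ((d + 2) * (d + 3)).
Proof.
move=> uphi; have [hermP [_ tr1]] := pure_density _ uphi.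
have nz : (d + 2) * (d + 3) * d != 0 by rewrite !mulf_neq0 // gt_eqF ?dk_gt0.
apply: (mulfI nz); rewrite pure_Vstar //.
set Phi := phi *m adj phi.
have PhiPhi : Phi *m Phi = Phi := pure_idem _ uphi.
rewrite !PhiPhi tr1; field.
by rewrite !gt_eqF ?dk_gt0.
Qed.

Lemma pure_Vstar_max (phi : 'cV[C]_D) (rho : 'M[C]_D) :
  unit_vector phi -> density rho ->
  Vstar_rho P U Minv (phi *m adj phi - d^-1%:M) rho <=
  4 * (d - 1) / ((d + 2) * (d + 3)).
Proof.
move=> uphi denr; have tr1 := proj2 (proj2 denr).
have [hermP _] := pure_density _ uphi.
(* The bounds are applied to the projection itself rather than to [O]: idempotence turns them into
   [0 <= f <= 1] and [g <= f]. *)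
have [l1 _ _ /andP[f0 f1] gf] := density_trace_bounds _ _ denr hermP.
have pos : 0 < (d + 2) * (d + 3) * d by rewrite !mulr_gt0 // dk_gt0.
rewrite -(ler_pM2l pos) pure_Vstar //.
set Phi := phi *m adj phi in hermP f0 f1 gf *.
have PhiPhi : Phi *m Phi = Phi := pure_idem _ uphi.
have trPhi : \tr Phi = 1 := pure_trace _ uphi.
rewrite -!(mulmxA _ Phi) PhiPhi in f0 f1 gf; rewrite trPhi in f1.
set f := \tr (rho *m Phi) in f0 f1 gf *; set g := \tr (rho *m rho *m Phi) in gf *.
set l := \tr (rho *m rho) in l1 *.
rewrite -(subr_ge0 l) in l1; rewrite -(subr_ge0 f) in f1; rewrite -(subr_ge0 g) in gf.
rewrite -subr_ge0.
have -> : (d + 2) * (d + 3) * d * (4 * (d - 1) / ((d + 2) * (d + 3))) -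
    (4 * d * (d - 1) - (d + 1) ^+ 2 * (1 - l) - (d + 1) * (2 * d - 2) * (f - g)
     - (1 - f) * ((d - 2) * (3 * d + 1) + (d ^+ 2 + d + 2) * f)) =
  (d + 1) ^+ 2 * (1 - l) + (d + 1) * (2 * (d - 2) + 2) * (f - g)
  + (1 - f) * ((d - 2) * (3 * d + 1) + (d ^+ 2 + d + 2) * f).
  by field; rewrite !gt_eqF ?dk_gt0.
have d1 := ltW (dk_gt0 1); have d0 := ltW d_gt0.
by do ![assumption | exact: ler0n | exact: ler01 | exact: exprn_ge0
  | apply: mulr_ge0 | apply: addr_ge0].
Qed.

End Variance.

(** The maximum over states is expressed by a bound valid for every [rho] and, in the pure case, by
    its attainment at [phi]. *)
Theorem theorem2 (R : realType) (n : nat) (dT : measure_display)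
  (T : measurableType dT) (P : probability T R)
  (U : T -> 'M[R[i]]_(2 ^ n)) (Minv : 'M[R[i]]_(2 ^ n) -> 'M[R[i]]_(2 ^ n)) :
  (1 <= n)%N ->
  unitary_design 4 P U ->
  channel_inverse P U Minv ->
  let d : R[i] := (2 ^ n)%:R in
  (forall O : 'M[R[i]]_(2 ^ n), is_hermitian O -> \tr O = 0 ->
     forall rho : 'M[R[i]]_(2 ^ n), density rho ->
       Vstar_rho P U Minv O rho <= 4 / d * hs_norm2 O)
  /\
  (forall phi : 'cV[R[i]]_(2 ^ n), unit_vector phi ->
     let O := phi *m adj phi - d^-1%:M in
     (forall rho : 'M[R[i]]_(2 ^ n), density rho ->
        Vstar_rho P U Minv O rho <= Vstar_rho P U Minv O (phi *m adj phi))
     /\ Vstar_rho P U Minv O (phi *m adj phi) = 4 * (d - 1) / ((d + 2) * (d + 3))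
     /\ 4 * (d - 1) / ((d + 2) * (d + 3)) < 4 / d).
Proof.
move=> n_ge1 designU invM d.
have D_gt1 : (1 < 2 ^ n)%N by rewrite -[1%N](expn0 2) ltn_exp2l.
split=> [obs herm_obs tr0 rho denr|phi uphi O].
  by rewrite /hs_norm2 /adj herm_obs; exact: Vstar_le.
split; last split.
- move=> rho denr; rewrite (pure_Vstar_self designU invM D_gt1 _ uphi).
  exact: pure_Vstar_max.
- exact: pure_Vstar_self.
have dk_gt0 k : 0 < d + k%:R by rewrite -natrD ltr0n addn_gt0 ltnW.
have d_gt0 : 0 < d by rewrite -[d]addr0; exact: (dk_gt0 0).
rewrite -subr_gt0.
(* The numerator comes from [(d + 2) (d + 3) - d (d - 1) = 6 (d + 1)]. *)
have -> : 4 / d - 4 * (d - 1) / ((d + 2) * (d + 3)) =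
    24 * (d + 1) / (d * (d + 2) * (d + 3)).
  by field; rewrite !gt_eqF ?dk_gt0.
by rewrite divr_gt0 ?mulr_gt0 ?(dk_gt0 1%N) ?dk_gt0 // ltr0n.
Qed.
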